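(* Let $V$ be a valuation ring with residue field $F$ and value group $\Gamma$, containing a field $k$; let $k'$ be a field extension of $k$, and let $p$ be the characteristic exponent of $k$. Then there exists a valuation ring $W$ dominating $V$ and containing $k'$ (compatibly with $k\subset V$), with the following properties, where $\Delta$ denotes the value group of $W$ and $F_1$ its residue field: (i) the group $\Delta/\Gamma$ is $p$-torsion; (ii) $F_1$ is purely inseparable over its subfield generated by $k'$ and $F$.
   Context: Rings are commutative with unit. The value group of a valuation ring $V$ with fraction field $K$ is the totally ordered abelian group $K^\times/V^\times$. A valuation ring $W$ dominates $V$ if it is given with an injective local homomorphism $V\to W$; this induces an injection of value groups $\Gamma\hookrightarrow\Delta$ and an embedding of residue fields. The characteristic exponent of a field is $1$ in characteristic $0$ and the characteristic otherwise. A group is ''$p$-torsion'' if each of its elements is killed by some power of $p$ (so it is trivial if $p=1$). *)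

(* Defs.v *)
From HB Require Import structures.
From mathcomp Require Import all_boot all_order all_algebra.
From mathcomp Require Import boolp classical_sets.

Set Implicit Arguments.
Unset Strict Implicit.
Unset Printing Implicit Defensive.

Import GRing.Theory.
Local Open Scope ring_scope.
Local Open Scope quotient_scope.

(* Fields are allowed (trivial valuation). *)
HB.mixin Record isValuationRing V of GRing.IntegralDomain V := {
  valuation_total : forall a b : V,
    (exists c, b = c * a) \/ (exists c, a = c * b)
}.

#[short(type="valuationRingType")]
HB.structure Definition ValuationRing :=
  {V of GRing.IntegralDomain V & isValuationRing V}.

Definition nonunits (V : valuationRingType) : {pred V} :=
  [pred x | x \isn't a GRing.unit].
Arguments nonunits V : clear implicits.

Lemma nonunits_idealr (V : valuationRingType) : idealr_closed (nonunits V).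
Proof.
have NM (a x : V) : x \isn't a GRing.unit -> a * x \isn't a GRing.unit.
  by apply: contra; rewrite unitrM => /andP[].
split; rewrite ?inE ?unitr0 ?unitr1 // => a u v; rewrite !inE => Nu Nv.
have {}Nu := NM a _ Nu; move: (a * u) Nu => {}u Nu.
case: (valuation_total u v) => -[c def_c].
  by rewrite def_c -[X in X + _]mul1r -mulrDl NM.
by rewrite def_c -[X in _ + X]mul1r -mulrDl NM.
Qed.

HB.instance Definition _ (V : valuationRingType) :=
  isIdealr.Build V (nonunits V) (@nonunits_idealr V).

Definition residue_field (V : valuationRingType) := {ideal_quot nonunits V}.

Section ResidueField.
Variable V : valuationRingType.

HB.instance Definition _ := GRing.ComNzRing.on (residue_field V).
HB.instance Definition _ := EqQuotient.on (residue_field V).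

Definition residue (x : V) : residue_field V := \pi_(residue_field V) x.

Lemma residue_eq (x y : V) :
  (residue x == residue y) = (x - y \isn't a GRing.unit).
Proof. by rewrite -Quotient.idealrBE. Qed.

Lemma residue_eq0 (x : V) : (residue x == 0) = (x \isn't a GRing.unit).
Proof.
have <-: residue 0 = 0 by rewrite /residue piE.
by rewrite residue_eq subr0.
Qed.

Lemma residue_is_zmod_morphism : zmod_morphism residue.
Proof. exact: (rmorphB (\pi_{ideal_quot nonunits V})). Qed.

Lemma residue_is_monoid_morphism : monoid_morphism residue.
Proof.
by split; [exact: (rmorph1 (\pi_{ideal_quot nonunits V}))
          |exact: (rmorphM (\pi_{ideal_quot nonunits V}))].
Qed.

HB.instance Definition _ := GRing.isZmodMorphism.Build V (residue_field V)
  residue residue_is_zmod_morphism.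
HB.instance Definition _ := GRing.isMonoidMorphism.Build V (residue_field V)
  residue residue_is_monoid_morphism.

Lemma repr_residue (x : residue_field V) : residue (repr x) = x.
Proof. exact: reprK. Qed.

(* As x^-1 = x in V when x is not a unit, this sends 0 to 0. *)
Definition residue_inv (x : residue_field V) : residue_field V :=
  residue (repr x)^-1.

Lemma residue_mulVf x : x != 0 -> residue_inv x * x = 1.
Proof.
rewrite -{1}[x]repr_residue residue_eq0 negbK => Ux.
by rewrite -{2}[x]repr_residue -rmorphM mulVr ?rmorph1.
Qed.

Lemma residue_inv0 : residue_inv 0 = 0.
Proof.
have: residue (repr (0 : residue_field V)) == 0 by rewrite repr_residue.
by rewrite residue_eq0 /residue_inv => /invr_out->; rewrite repr_residue.
Qed.

HB.instance Definition _ := GRing.ComNzRing_isField.Build (residue_field V)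
  residue_mulVf residue_inv0.

End ResidueField.

(* K^* as an abelian group, written additively so that MathComp's quotients
   of zmodTypes apply: x + y, - x and 0 are x y, x^-1 and 1 in K. *)
Record mulgroup (K : fieldType) :=
  MulGroup { mgval : K; mgval_neq0 : mgval != 0 }.

Section MulGroup.
Variable K : fieldType.

HB.instance Definition _ := [isSub for @mgval K].
HB.instance Definition _ := [Choice of mulgroup K by <:].

Definition mg_zero := @MulGroup K 1 (oner_neq0 K).
Definition mg_opp (x : mulgroup K) :=
  @MulGroup K (mgval x)^-1 (invr_neq0 (mgval_neq0 x)).
Definition mg_add (x y : mulgroup K) :=
  @MulGroup K (mgval x * mgval y) (mulf_neq0 (mgval_neq0 x) (mgval_neq0 y)).

Lemma mg_addA : associative mg_add.
Proof. by move=> x y z; apply: val_inj; rewrite /= mulrA. Qed.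
Lemma mg_addC : commutative mg_add.
Proof. by move=> x y; apply: val_inj; rewrite /= mulrC. Qed.
Lemma mg_add0 : left_id mg_zero mg_add.
Proof. by move=> x; apply: val_inj; rewrite /= mul1r. Qed.
Lemma mg_addN : left_inverse mg_zero mg_opp mg_add.
Proof. by move=> x; apply: val_inj; rewrite /= mulVf // mgval_neq0. Qed.

HB.instance Definition _ :=
  GRing.isZmodule.Build (mulgroup K) mg_addA mg_addC mg_add0 mg_addN.

Lemma mgvalB (x y : mulgroup K) : mgval (x - y) = mgval x / mgval y.
Proof. by []. Qed.

End MulGroup.

Section ValueGroup.
Variable V : valuationRingType.

(* V^* as a subgroup of K^*, with K = {fraction V} *)
Definition unit_subgroup : {pred mulgroup {fraction V}} :=
  [pred x | `[< exists2 u : V, u \is a GRing.unit &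
                               mgval x = FracField.tofrac u >] ].

Lemma unit_subgroupP (x : mulgroup {fraction V}) :
  reflect (exists2 u : V, u \is a GRing.unit & mgval x = FracField.tofrac u)
          (x \in unit_subgroup).
Proof. exact: asboolP. Qed.

Lemma unit_subgroup_closed : zmod_closed unit_subgroup.
Proof.
split=> [|x y /unit_subgroupP[u Uu Dx] /unit_subgroupP[v Uv Dy]];
  apply/unit_subgroupP; first by exists 1; rewrite ?unitr1 ?rmorph1.
exists (u / v); first by rewrite unitrM unitrV Uu.
by rewrite mgvalB Dx Dy rmorphM rmorphV.
Qed.

HB.instance Definition _ := GRing.isZmodClosed.Build _ unit_subgroup
  unit_subgroup_closed.

Definition value_group := {ideal_quot unit_subgroup}.

HB.instance Definition _ := GRing.Zmodule.on value_group.
HB.instance Definition _ := EqQuotient.on value_group.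

Definition value (x : mulgroup {fraction V}) : value_group :=
  \pi_value_group x.

Lemma value_eq x y : (value x == value y) = (x - y \in unit_subgroup).
Proof. by rewrite Quotient.idealrBE. Qed.

Lemma value_is_zmod_morphism : zmod_morphism value.
Proof. exact: (raddfB (\pi_{ideal_quot unit_subgroup})). Qed.

HB.instance Definition _ := GRing.isZmodMorphism.Build _ value_group
  value value_is_zmod_morphism.

Lemma repr_value (x : value_group) : value (repr x) = x.
Proof. exact: reprK. Qed.

End ValueGroup.
Arguments unit_subgroup V : clear implicits.

Record domination (V W : valuationRingType) := Domination {
  dom_map :> {rmorphism V -> W};
  dom_inj : injective dom_map;
  dom_local : forall x, dom_map x \is a GRing.unit -> x \is a GRing.unit
}.

Section Domination.
Variables (V W : valuationRingType) (phi : domination V W).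
Local Notation "x %:F" := (FracField.tofrac x).

Definition residue_map (x : residue_field V) : residue_field W :=
  residue (phi (repr x)).

Lemma residue_mapE x : residue_map (residue x) = residue (phi x).
Proof.
apply/eqP; rewrite residue_eq -rmorphB.
apply: contra (@dom_local _ _ phi _) _.
by rewrite -residue_eq repr_residue.
Qed.

Lemma residue_map_is_zmod_morphism : zmod_morphism residue_map.
Proof.
move=> x y; rewrite -[x]repr_residue -[y]repr_residue.
by rewrite -rmorphB !residue_mapE !rmorphB.
Qed.

Lemma residue_map_is_monoid_morphism : monoid_morphism residue_map.
Proof.
split=> [|x y]; first by rewrite -(rmorph1 (@residue V)) residue_mapE !rmorph1.
rewrite -[x]repr_residue -[y]repr_residue.
by rewrite -rmorphM !residue_mapE !rmorphM.
Qed.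

HB.instance Definition _ := GRing.isZmodMorphism.Build
  (residue_field V) (residue_field W) residue_map residue_map_is_zmod_morphism.
HB.instance Definition _ := GRing.isMonoidMorphism.Build
  (residue_field V) (residue_field W) residue_map
  residue_map_is_monoid_morphism.

Definition frac_map (x : {fraction V}) : {fraction W} :=
  (phi \n_(repr x))%:F / (phi \d_(repr x))%:F.

Lemma frac_repr (x : {fraction V}) : x = (\n_(repr x))%:F / (\d_(repr x))%:F.
Proof.
have Fn0: (\d_(repr x))%:F != 0 by rewrite tofrac_eq0 denom_ratioP.
apply: (mulIf Fn0); rewrite divfK // -{1}[x]reprK.
move: (repr x) => {Fn0} {}x; unlock FracField.tofrac; rewrite -[LHS]FracField.pi_mul.
apply/eqmodP; rewrite /= FracField.equivfE /FracField.mulf.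
by rewrite !numden_Ratio ?mulr1 ?oner_eq0 ?denom_ratioP // mulrC.
Qed.

Lemma phi_neq0 x : x != 0 -> (phi x)%:F != 0.
Proof. by rewrite tofrac_eq0 -(inj_eq (@dom_inj _ _ phi)) rmorph0. Qed.

Lemma frac_mapE n d : d != 0 ->
  frac_map (n%:F / d%:F) = (phi n)%:F / (phi d)%:F.
Proof.
move=> nz_d; move Dy: (n%:F / d%:F) => y.
rewrite /frac_map; have nz_dy := denom_ratioP (repr y).
move: Dy; rewrite {1}[y]frac_repr => /eqP.
rewrite eqr_div ?tofrac_eq0 // -!rmorphM tofrac_eq => /eqP Dy.
by apply/eqP; rewrite eqr_div ?phi_neq0 // -!rmorphM tofrac_eq Dy.
Qed.

Lemma frac_map_tofrac a : frac_map a%:F = (phi a)%:F.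
Proof.
by have := frac_mapE a (oner_neq0 V); rewrite !rmorph1 !divr1.
Qed.

Lemma frac_mapM : {morph frac_map : x y / x * y}.
Proof.
move=> x y; rewrite [x]frac_repr [y]frac_repr mulf_div -!rmorphM.
by rewrite !frac_mapE ?mulf_neq0 ?denom_ratioP // !rmorphM mulf_div.
Qed.

Lemma frac_map_neq0 x : x != 0 -> frac_map x != 0.
Proof.
move=> nz_x; apply/eqP => Fx0; have /eqP := frac_map_tofrac 1.
by rewrite !rmorph1 -(mulfV nz_x) frac_mapM Fx0 mul0r eq_sym oner_eq0.
Qed.

Definition mulgroup_map (x : mulgroup {fraction V}) :
    mulgroup {fraction W} :=
  MulGroup (frac_map_neq0 (mgval_neq0 x)).

Lemma mulgroup_map_is_zmod_morphism : zmod_morphism mulgroup_map.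
Proof.
move=> x y; apply: (addIr (mulgroup_map y)); rewrite subrK.
by apply: val_inj; rewrite /= -frac_mapM -[_ * _]/(mgval (x - y + y)) subrK.
Qed.

HB.instance Definition _ := GRing.isZmodMorphism.Build
  (mulgroup {fraction V}) (mulgroup {fraction W}) mulgroup_map
  mulgroup_map_is_zmod_morphism.

Lemma mulgroup_map_unit x :
  (mulgroup_map x \in unit_subgroup W) = (x \in unit_subgroup V).
Proof.
apply/unit_subgroupP/unit_subgroupP=> [[u Uu /= Dx] | [u Uu Dx]]; last first.
  by exists (phi u); rewrite ?rmorph_unit //= Dx frac_map_tofrac.
have nz_d := denom_ratioP (repr (mgval x)).
have nz_pd := phi_neq0 nz_d.
have nz_n: \n_(repr (mgval x)) != 0.
  apply: contraNneq (mgval_neq0 x) => n0.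
  by rewrite [mgval x]frac_repr n0 rmorph0 mul0r.
have Dn: phi \n_(repr (mgval x)) = u * phi \d_(repr (mgval x)).
  by apply/eqP; rewrite -tofrac_eq tofracM -Dx divfK.
case: (@valuation_total V \d_(repr (mgval x)) \n_(repr (mgval x))) => -[c Dc].
  exists c; last by rewrite {1}[mgval x]frac_repr {1}Dc rmorphM mulfK ?tofrac_eq0.
  apply: (@dom_local _ _ phi); suff -> : phi c = u by [].
  apply: (mulIf (x := phi \d_(repr (mgval x)))); last by rewrite -Dn -rmorphM -Dc.
  by rewrite -tofrac_eq0.
have Ucu: phi c * u = 1.
  apply: (mulIf (x := phi \d_(repr (mgval x)))); first by rewrite -tofrac_eq0.
  by rewrite -mulrA -Dn mul1r -rmorphM -Dc.
have Uc: c \is a GRing.unit.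
  apply: (@dom_local _ _ phi); apply/unitrP; exists u.
  by rewrite Ucu mulrC Ucu.
exists c^-1; first by rewrite unitrV.
rewrite {1}[mgval x]frac_repr {1}Dc rmorphM invfM mulrCA divff ?tofrac_eq0 //.
by rewrite mulr1 rmorphV.
Qed.

Definition value_map (g : value_group V) : value_group W :=
  value (mulgroup_map (repr g)).

Lemma value_mapE x : value_map (value x) = value (mulgroup_map x).
Proof.
apply/eqP; rewrite value_eq -raddfB mulgroup_map_unit.
by rewrite -value_eq repr_value.
Qed.

Lemma value_map_is_zmod_morphism : zmod_morphism value_map.
Proof.
move=> x y; rewrite -[x]repr_value -[y]repr_value.
by rewrite -raddfB !value_mapE !raddfB.
Qed.

HB.instance Definition _ := GRing.isZmodMorphism.Build
  (value_group V) (value_group W) value_map value_map_is_zmod_morphism.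

Lemma value_map_inj : injective value_map.
Proof.
move=> x y; rewrite -[x]repr_value -[y]repr_value !value_mapE => /eqP.
by rewrite value_eq -raddfB mulgroup_map_unit -value_eq => /eqP.
Qed.

Definition value_image : {pred value_group W} :=
  [pred d | `[< exists g, d = value_map g >] ].

Lemma value_image_closed : zmod_closed value_image.
Proof.
split=> [|_ _ /asboolP[x ->] /asboolP[y ->]]; apply/asboolP.
  by exists 0; rewrite raddf0.
by exists (x - y); rewrite raddfB.
Qed.

HB.instance Definition _ := GRing.isZmodClosed.Build _ value_image
  value_image_closed.

Definition value_quotient := {ideal_quot value_image}.

HB.instance Definition _ := GRing.Zmodule.on value_quotient.

End Domination.

Definition char_exponent (k : fieldType) (p : nat) : Prop :=
  p \in [pchar k] \/ p = 1%N /\ [pchar k] =i pred0.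

(* The group is written additively. *)
Definition p_torsion (p : nat) (G : zmodType) : Prop :=
  forall x : G, exists n : nat, x *+ (p ^ n)%N = 0.

Definition subfield_generated (L : fieldType) (A : set L) : set L :=
  smallest (fun S : set L => divring_closed [pred x in S]) A.

(* [pchar L].-nat e means that e is a power of the characteristic exponent of
   L; the extension is not assumed to be finite, unlike in
   mathcomp.field.separable. *)
Definition purely_inseparable_over (L : fieldType) (E : set L) : Prop :=
  forall x : L, exists2 e : nat, [pchar L].-nat e & E (x ^+ e).

(* Main.v *)
Require Import Defs.
From HB Require Import structures.
From mathcomp Require Import all_boot all_order all_algebra all_field.
From mathcomp Require Import boolp classical_sets.
From mathcomp Require Import ring.

Set Implicit Arguments.
Unset Strict Implicit.
Unset Printing Implicit Defensive.

Import GRing.Theory.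
Local Open Scope ring_scope.
Local Open Scope quotient_scope.

(** Valuation rings are handled as subrings O of a field N. A model consists of
    such a pair (N, O), an embedding of K = Frac V in N for which O lies above
    V, and an embedding in O of a field S between k and k'. It is required that
    every nonzero element x of the subfield generated by K and S has some power
    x^(p^n) of the same value as an element of K, and that, when x is in O, the
    residue of some x^(p^n) is a quotient of residues of elements of V[S]. The
    theorem says that there is a model with S = k'; its ring O, cut down to the
    field generated by K and k', is W.

    Models are ordered by extension, comparing only the subfields generated by K
    and S. The field generated by K and S, with its valuation, is determined by
    telling which formal expressions (terms) in elements of K and S vanish and
    which are integral. The union of a chain of models is therefore a quotient
    of the set of terms, and Zorn's lemma applies (full_model).

    It remains to enlarge a model with S different from k' by one element a
    (model_step). If a is transcendental over S, a is sent to the residually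
    transcendental element t of N(t) with its Gauss valuation: values do not
    change, and residues are only enlarged by that of a (transcendental_datum).
    If a^p is in S, a p-th root of its image is adjoined to N; the subfield
    generated by this root and the old one has its p-th powers in the old one
    (radical_datum). Otherwise a choice of a of minimal degree makes its minimal
    polynomial f over S irreducible and separable, so that the roots of f in an
    extension of (N, O) have distinct residues. Let y be one of them. First a
    root z of a lift H of the minimal polynomial of the residue of y is
    adjoined; as for the Gauss valuation, the value of a polynomial g(z) of
    degree less than deg H is the minimum of the values of the coefficients
    (residue_generator). Then y, which is congruent to z, is adjoined, and this
    extension is immediate (simple_root_immediate). The reason is that for n
    large the element g(y) (y - z)^n has another value than g(x) (x - z)^n for
    every root x of f other than y, because x - z is then a unit while y - z is
    not. The element g(y) (y - z)^n is then, up to a factor congruent to 1, a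
    quotient of two consecutive coefficients of the polynomial with roots g(x)
    (x - z)^n, and these coefficients lie in the field generated by z
    (norm_poly). The case g = 1 gives the same for (y - z)^n, hence for the
    quotient g(y). *)

(** * Valuation subrings of a field *)

(** The totality axiom covers 0, as the inverse of 0 is 0. *)
Record valsub (N : fieldType) := ValSub {
  vs_pred : {pred N};
  vs_closed : subring_closed vs_pred;
  vs_total : forall x, (x \in vs_pred) || (x^-1 \in vs_pred)
}.

(** A copy of the predicate that carries the subring structure. *)
Definition vsring (N : fieldType) (O : valsub N) : {pred N} := vs_pred O.
HB.instance Definition _ (N : fieldType) (O : valsub N) :=
  GRing.isSubringClosed.Build N (vsring O) (vs_closed O).

Section Valsub.
Variables (N : fieldType) (O : valsub N).
Implicit Types x y z : N.

Definition vsmax : {pred N} := [pred x | (x == 0) || (x^-1 \notin vsring O)].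
Definition vsunit : {pred N} :=
  [pred x | [&& x != 0, x \in vsring O & x^-1 \in vsring O]].

Lemma vsP x : (x \in vsring O) || (x^-1 \in vsring O).
Proof. exact: (vs_total O). Qed.

Lemma mem_vsmax x : (x \in vsmax) = (x == 0) || (x^-1 \notin vsring O).
Proof. by []. Qed.

Lemma mem_vsunit x : (x \in vsunit) =
  [&& x != 0, x \in vsring O & x^-1 \in vsring O].
Proof. by []. Qed.

Lemma vsmaxW x : x \in vsmax -> x \in vsring O.
Proof.
rewrite inE => /orP[/eqP->|]; first exact: rpred0.
by have /orP[//|->] := vsP x.
Qed.

Lemma vsunitW x : x \in vsunit -> x \in vsring O.
Proof. by case/and3P. Qed.

Lemma vsunit_neq0 x : x \in vsunit -> x != 0.
Proof. by case/and3P. Qed.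

Lemma vsunitE x : (x \in vsunit) = (x \in vsring O) && (x \notin vsmax).
Proof.
rewrite !inE negb_or negbK.
by case: (x == 0); rewrite ?andbF //=.
Qed.

Lemma vsunit_max x : x \in vsring O -> (x \in vsunit) = (x \notin vsmax).
Proof. by rewrite vsunitE => ->. Qed.

Lemma vsunit1 : 1 \in vsunit.
Proof. by rewrite inE oner_neq0 invr1 rpred1. Qed.

Lemma vsunitM x y : x \in vsunit -> y \in vsunit -> x * y \in vsunit.
Proof.
move=> /and3P[x0 xO xVO] /and3P[y0 yO yVO].
by rewrite inE mulf_neq0 //= invfM !rpredM.
Qed.

Lemma vsunitV x : x \in vsunit -> x^-1 \in vsunit.
Proof. by case/and3P=> x0 xO xVO; rewrite inE invr_eq0 invrK x0 xO xVO. Qed.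

Lemma vsunitVE x : (x^-1 \in vsunit) = (x \in vsunit).
Proof. by apply/idP/idP=> /vsunitV //; rewrite invrK. Qed.

Lemma vsunit_prod (I : Type) (r : seq I) (P : pred I) (F : I -> N) :
  (forall i, P i -> F i \in vsunit) -> \prod_(i <- r | P i) F i \in vsunit.
Proof.
move=> FU; elim/big_ind: _ => //; [exact: vsunit1|exact: vsunitM].
Qed.

Lemma vsunitX x n : x \in vsunit -> x ^+ n \in vsunit.
Proof.
by move=> xU; elim: n => [|n IHn]; rewrite ?vsunit1 // exprS vsunitM.
Qed.

Lemma vsmaxM x y : x \in vsring O -> y \in vsmax -> x * y \in vsmax.
Proof.
move=> xO; rewrite !inE mulf_eq0 invfM => /orP[->|yV]; first by rewrite orbT.
have [->|x0] /= := eqVneq x 0; first by [].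
have [//|y0] /= := eqVneq y 0.
by apply: contra yV => /(rpredM xO); rewrite mulVKf.
Qed.

Lemma vsmaxMl x y : x \in vsmax -> y \in vsring O -> x * y \in vsmax.
Proof. by move=> xm yO; rewrite mulrC vsmaxM. Qed.

Lemma vsmax0 : 0 \in vsmax. Proof. by rewrite inE eqxx. Qed.

Lemma vsmax1 : 1 \notin vsmax.
Proof. by have := vsunit1; rewrite vsunitE => /andP[]. Qed.

Lemma vsmaxN x : x \in vsmax -> - x \in vsmax.
Proof. by rewrite -mulN1r; apply: vsmaxM; rewrite rpredN rpred1. Qed.

Lemma vsmaxD x y : x \in vsmax -> y \in vsmax -> x + y \in vsmax.
Proof.
move=> xm ym; have [->|x0] := eqVneq x 0; first by rewrite add0r.
have [->|y0] := eqVneq y 0; first by rewrite addr0.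
have /orP[xy|] := vsP (x / y).
  have -> : x + y = (x / y + 1) * y by rewrite mulrDl divfK // mul1r.
  by rewrite vsmaxM // rpredD ?rpred1.
rewrite invf_div => yx.
have -> : x + y = (1 + y / x) * x by rewrite mulrDl divfK // mul1r.
by rewrite vsmaxM // rpredD ?rpred1.
Qed.

Lemma vsmax_zmod_closed : zmod_closed vsmax.
Proof.
by split=> [|x y xm ym]; [exact: vsmax0|rewrite vsmaxD ?vsmaxN].
Qed.
HB.instance Definition _ := GRing.isZmodClosed.Build N vsmax vsmax_zmod_closed.

Lemma vsmax_prime x y : x \in vsring O -> y \in vsring O ->
  (x * y \in vsmax) = (x \in vsmax) || (y \in vsmax).
Proof.
move=> xO yO; apply/idP/orP => [xy|[xm|ym]]; last 2 first.
- by rewrite vsmaxMl.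
- by rewrite vsmaxM.
case xm: (x \in vsmax); [by left|right].
have xU : x \in vsunit by rewrite vsunit_max ?xm.
rewrite -(mulKf (vsunit_neq0 xU) y) vsmaxM //.
by rewrite vsunitW ?vsunitV.
Qed.

Lemma vsunitD x y : x \in vsunit -> y \in vsmax -> x + y \in vsunit.
Proof.
rewrite !vsunitE => /andP[xO xm] ym.
rewrite rpredD ?(vsmaxW ym) //=; apply: contra xm => xym.
by rewrite -[x](addrK y) rpredB.
Qed.

Lemma vsunit_cong x y : x \in vsunit -> x - y \in vsmax -> y \in vsunit.
Proof. by move=> xU xy; rewrite -[y](subKr x) vsunitD ?rpredN. Qed.

Lemma vsunit_root x n : (0 < n)%N -> x ^+ n \in vsunit -> x \in vsunit.
Proof.
have key z : (0 < n)%N -> z \in vsring O -> z ^+ n \in vsunit -> z \in vsunit.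
  case: n => // n _ zO; rewrite !vsunit_max ?rpredX // exprS.
  by rewrite vsmax_prime ?rpredX // negb_or => /andP[].
move=> n0 xn; have /orP[xO|xO] := vsP x; first exact: key.
by rewrite -vsunitVE key // exprVn vsunitVE.
Qed.

Lemma vs_root x n : (0 < n)%N -> x ^+ n \in vsring O -> x \in vsring O.
Proof.
move=> n0 xn; have /orP[//|xVO] := vsP x.
have [xm|xm] := boolP (x^-1 \in vsmax); last first.
  by rewrite -[x]invrK vsunitW // vsunitVE vsunit_max.
case: n n0 xn => // n _ xn; have [->|x0] := eqVneq x 0; first exact: rpred0.
suff : 1 \in vsmax by rewrite (negbTE vsmax1).
have -> : 1 = x ^+ n.+1 * (x^-1) ^+ n.+1 by rewrite -exprMn divff // expr1n.
by rewrite vsmaxM // exprSr vsmaxM ?rpredX.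
Qed.

(** Valuation rings are integrally closed: dividing the equation of x by a
    power of x writes x as a polynomial in its inverse. *)
Lemma vs_integral (f : {poly N}) x :
  f \is a polyOver (vsring O) -> f \is monic -> root f x -> x \in vsring O.
Proof.
move=> fO /monicP fm fx; have /orP[//|xVO] := vsP x.
have [->|x0] := eqVneq x 0; first exact: rpred0.
move: fx; rewrite /root horner_coef => /eqP.
have : (0 < size f)%N by rewrite size_poly_gt0 -lead_coef_eq0 fm oner_eq0.
case sf: (size f) => [//|n] _; rewrite big_ord_recr /=.
have -> : f`_n = 1 by rewrite -fm lead_coefE sf.
rewrite mul1r => /eqP; rewrite addr_eq0 => /eqP fx.
case: n sf fx => [|n] sf fx.
  by move: fx; rewrite big_ord0 expr0 => /eqP; rewrite eq_sym oppr_eq0 oner_eq0.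
have -> : x = - \sum_(i < n.+1) f`_i * x^-1 ^+ (n - i).
  transitivity (- (- x ^+ n.+1) * x^-1 ^+ n).
    by rewrite opprK exprSr exprVn -mulrA mulrC -mulrA mulVf ?mulr1 // expf_neq0.
  rewrite -fx mulNr big_distrl /=; congr (- _); apply: eq_bigr => i _.
  rewrite -mulrA; congr (_ * _); have in_ : (i <= n)%N by rewrite -ltnS.
  by rewrite -{2}(subnK in_) exprD mulrCA -exprMn divff // expr1n mulr1.
rewrite rpredN rpred_sum // => i _; rewrite rpredM ?rpredX //.
exact: (polyOverP fO).
Qed.

End Valsub.

Lemma vsmax_map (N N' : fieldType) (O : valsub N) (O' : valsub N')
    (f : {rmorphism N -> N'}) :
  (forall x, (f x \in vsring O') = (x \in vsring O)) ->
  forall x, (f x \in vsmax O') = (x \in vsmax O).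
Proof. by move=> fO x; rewrite !inE fmorph_eq0 -fmorphV fO. Qed.

Lemma vsunit_map (N N' : fieldType) (O : valsub N) (O' : valsub N')
    (f : {rmorphism N -> N'}) :
  (forall x, (f x \in vsring O') = (x \in vsring O)) ->
  forall x, (f x \in vsunit O') = (x \in vsunit O).
Proof. by move=> fO x; rewrite !inE fmorph_eq0 -fmorphV !fO. Qed.

Definition vtype (N : fieldType) (O : valsub N) := {x : N | x \in vsring O}.

Definition vt_mk (N : fieldType) (O : valsub N) (x : N) (xO : x \in vsring O) :
  vtype O := exist _ x xO.

Section Vtype.
Variables (N : fieldType) (O : valsub N).
HB.instance Definition _ := SubChoice.on (vtype O).
HB.instance Definition _ := [SubChoice_isSubComNzRing of vtype O by <:].

Definition vt_unit : {pred vtype O} := [pred x | val x \in vsunit O].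
Definition vt_inv (x : vtype O) : vtype O := insubd x (val x)^-1.

Lemma vt_invE x : x \in vt_unit -> val (vt_inv x) = (val x)^-1.
Proof. by case/and3P=> _ _ xO; rewrite val_insubd xO. Qed.

Lemma vt_mulVx : {in vt_unit, left_inverse 1 vt_inv *%R}.
Proof.
move=> x xU; apply: val_inj; rewrite /= vt_invE // mulVf //.
exact: vsunit_neq0 xU.
Qed.

Lemma vt_unitPl (x y : vtype O) : y * x = 1 -> x \in vt_unit.
Proof.
move=> /(congr1 val) /= yx; rewrite inE inE (valP x).
have x0 : val x != 0.
  by apply/eqP=> x0; move: yx; rewrite x0 mulr0 => /eqP; rewrite eq_sym oner_eq0.
rewrite x0 /=; suff -> : (val x)^-1 = val y by exact: (valP y).
by apply: (mulIf x0); rewrite mulVf.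
Qed.

Lemma vt_inv0id : {in [predC vt_unit], vt_inv =1 id}.
Proof.
move=> x; rewrite !inE (valP x) /= negb_and negbK => xU.
rewrite /vt_inv /insubd; case: insubP => //= u uO uE.
move: xU; rewrite uO orbF => /eqP x0.
by apply: val_inj; rewrite /= uE x0 invr0.
Qed.

HB.instance Definition _ := GRing.ComNzRing_hasMulInverse.Build (vtype O)
  vt_mulVx vt_unitPl vt_inv0id.

Lemma vt_mulf_eq0 : GRing.integral_domain_axiom (vtype O).
Proof.
move=> x y /(congr1 val) /= /eqP; rewrite mulf_eq0.
by case/orP=> /eqP x0; apply/orP; [left|right]; apply/eqP/val_inj.
Qed.
HB.instance Definition _ :=
  GRing.ComUnitRing_isIntegral.Build (vtype O) vt_mulf_eq0.

Lemma vt_total (a b : vtype O) :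
  (exists c, b = c * a) \/ (exists c, a = c * b).
Proof.
have [->|a0] := eqVneq a 0; first by right; exists 0; rewrite mul0r.
have [->|b0] := eqVneq b 0; first by left; exists 0; rewrite mul0r.
have va0 : val a != 0 by rewrite -(inj_eq val_inj) in a0.
have vb0 : val b != 0 by rewrite -(inj_eq val_inj) in b0.
have /orP[ab|] := vsP O (val a / val b).
  by right; exists (vt_mk ab); apply: val_inj; rewrite /= divfK.
rewrite invf_div => ba.
by left; exists (vt_mk ba); apply: val_inj; rewrite /= divfK.
Qed.
HB.instance Definition _ := isValuationRing.Build (vtype O) vt_total.

Lemma vt_unitE (x : vtype O) : (x \is a GRing.unit) = (val x \in vsunit O).
Proof. by []. Qed.

Definition vt_val : {rmorphism vtype O -> N} := \val.

End Vtype.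

(** * Extension of valuation rings *)

(** Closed predicates known only through a hypothesis, tagged with the proof so
    that the structure can be inferred. *)
Definition mk_zmod (R : zmodType) (B : {pred R}) of zmod_closed B := B.
HB.instance Definition _ (R : zmodType) (B : {pred R}) (sB : zmod_closed B) :=
  GRing.isZmodClosed.Build R (mk_zmod sB) sB.

Definition mk_subring (R : nzRingType) (B : {pred R}) of subring_closed B := B.
HB.instance Definition _ (R : nzRingType) (B : {pred R})
    (sB : subring_closed B) :=
  GRing.isSubringClosed.Build R (mk_subring sB) sB.

Section Chevalley.
Variables (N : fieldType).

(** A subring together with one of its proper ideals. Predicates are plain
    boolean functions, which keeps the pairs in a universe where Zorn's lemma
    applies. *)
Record proper_pair (X : (N -> bool) * (N -> bool)) : Prop := ProperPair {
  pp_ring : subring_closed X.1;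
  pp_zmod : zmod_closed X.2;
  pp_sub : {subset X.2 <= X.1};
  pp_mul : forall x y, x \in X.1 -> y \in X.2 -> x * y \in X.2;
  pp_proper : 1 \notin X.2
}.

Definition pair_le (X Y : (N -> bool) * (N -> bool)) :=
  {subset X.1 <= Y.1} /\ {subset X.2 <= Y.2}.

Lemma proper_pair_chain (A : (N -> bool) * (N -> bool) -> Prop) X0 :
  A X0 -> (forall X, A X -> proper_pair X) ->
  (forall X Y, A X -> A Y -> pair_le X Y \/ pair_le Y X) ->
  exists2 Z, proper_pair Z & forall X, A X -> pair_le X Z.
Proof.
move=> A0 Ap Atot.
pose U1 : N -> bool := [pred x | `[< exists2 X, A X & x \in X.1 >]].
pose U2 : N -> bool := [pred x | `[< exists2 X, A X & x \in X.2 >]].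
have U1P x : reflect (exists2 X, A X & x \in X.1) (x \in U1) by exact: asboolP.
have U2P x : reflect (exists2 X, A X & x \in X.2) (x \in U2) by exact: asboolP.
have join X Y : A X -> A Y ->
    exists Z, [/\ A Z, pair_le X Z & pair_le Y Z].
  move=> AX AY; have [XY|YX] := Atot _ _ AX AY.
    by exists Y; split=> //; split.
  by exists X; split=> //; split.
exists (U1, U2); last first.
  by move=> X AX; split=> x Xx; [apply/U1P|apply/U2P]; exists X.
split=> /=.
- split=> [|x y /U1P[X AX Xx] /U1P[Y AY Yy]|x y /U1P[X AX Xx] /U1P[Y AY Yy]].
  + by apply/U1P; exists X0; case: (pp_ring (Ap _ A0)).
  + have [Z [AZ [XZ _] [YZ _]]] := join _ _ AX AY.
    apply/U1P; exists Z => //; case: (pp_ring (Ap _ AZ)) => _ + _.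
    by apply; [exact: XZ|exact: YZ].
  + have [Z [AZ [XZ _] [YZ _]]] := join _ _ AX AY.
    apply/U1P; exists Z => //; case: (pp_ring (Ap _ AZ)) => _ _.
    by apply; [exact: XZ|exact: YZ].
- split=> [|x y /U2P[X AX Xx] /U2P[Y AY Yy]].
  + by apply/U2P; exists X0; case: (pp_zmod (Ap _ A0)).
  + have [Z [AZ [_ XZ] [_ YZ]]] := join _ _ AX AY.
    apply/U2P; exists Z => //; case: (pp_zmod (Ap _ AZ)) => _.
    by apply; [exact: XZ|exact: YZ].
- by move=> x /U2P[X AX Xx]; apply/U1P; exists X => //; apply: (pp_sub (Ap _ AX)).
- move=> x y /U1P[X AX Xx] /U2P[Y AY Yy].
  have [Z [AZ [XZ _] [_ YZ]]] := join _ _ AX AY.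
  by apply/U2P; exists Z => //; apply: (pp_mul (Ap _ AZ)); [exact: XZ|exact: YZ].
- by apply/negP=> /U2P[X AX]; apply/negP/(pp_proper (Ap _ AX)).
Qed.

(** Adjoining x to a proper pair keeps it proper unless 1 becomes a
    combination of powers of x with coefficients in the ideal. *)
Lemma proper_pair_adjoin X x : proper_pair X ->
    ~ (exists2 g : {poly N}, g \is a polyOver X.2 & g.[x] = 1) ->
  exists2 Y, proper_pair Y & pair_le X Y /\ x \in Y.1.
Proof.
case: X => B I [/= sB zI IB BI I1] no1.
pose B' := mk_subring sB; pose I' := mk_zmod zI.
pose B1 : N -> bool :=
  [pred y | `[< exists2 g : {poly N}, g \is a polyOver B' & y = g.[x] >]].
pose I2 : N -> bool :=
  [pred y | `[< exists2 g : {poly N}, g \is a polyOver I' & y = g.[x] >]].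
have B1P y : reflect (exists2 g : {poly N}, g \is a polyOver B' & y = g.[x])
  (y \in B1) by exact: asboolP.
have I2P y : reflect (exists2 g : {poly N}, g \is a polyOver I' & y = g.[x])
  (y \in I2) by exact: asboolP.
exists (B1, I2); last first.
  split; [split=> y /= yX|].
  - apply/B1P; exists y%:P; rewrite ?hornerC //.
    by rewrite polyOverC.
  - apply/I2P; exists y%:P; rewrite ?hornerC //.
    by rewrite polyOverC.
  - by apply/B1P; exists 'X; rewrite ?hornerX ?polyOverX.
split=> /=.
- split=> [|_ _ /B1P[g gB ->] /B1P[h hB ->]|_ _ /B1P[g gB ->] /B1P[h hB ->]].
  + by apply/B1P; exists 1; rewrite ?hornerC ?rpred1.
  + by apply/B1P; exists (g - h); rewrite ?hornerE ?rpredB.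
  + by apply/B1P; exists (g * h); rewrite ?hornerM ?rpredM.
- split=> [|_ _ /I2P[g gB ->] /I2P[h hB ->]].
  + by apply/I2P; exists 0; rewrite ?hornerC ?rpred0.
  + by apply/I2P; exists (g - h); rewrite ?hornerE ?rpredB.
- move=> _ /I2P[g /polyOverP gI ->]; apply/B1P; exists g => //.
  by apply/polyOverP=> i; apply/IB/gI.
- move=> _ _ /B1P[g /polyOverP gB ->] /I2P[h /polyOverP hI ->].
  apply/I2P; exists (g * h); rewrite ?hornerM //.
  apply/polyOverP=> i; rewrite coefM; apply: rpred_sum => j _.
  by apply: BI; [exact: gB|exact: hI].
- by apply/negP=> /I2P[g gI g1]; apply: no1; exists g.
Qed.

(** The degrees of two relations expressing 1 through powers of y and of its
    inverse can be lowered forever: the relation of smaller degree is used to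
    eliminate the leading term of the other one. *)
Lemma proper_pair_inv X y z : proper_pair X -> y * z = 1 ->
    (exists2 g : {poly N}, g \is a polyOver X.2 & g.[y] = 1) ->
    (exists2 h : {poly N}, h \is a polyOver X.2 & h.[z] = 1) -> False.
Proof.
case: X => B I [/= sB zI IB BI I1].
pose I' := mk_zmod zI; move=> yz [g gI gy] [h hI hz].
have {}gI : g \is a polyOver I' by [].
have {}hI : h \is a polyOver I' by [].
have [n le_n] := ubnP (size g + size h).
elim: n => // n IHn in y z yz g h gI gy hI hz le_n *.
wlog le_hg : y z yz g h gI gy hI hz le_n / (size h <= size g)%N.
  move=> W; have [|/ltnW] := leqP (size h) (size g); first exact: (W y z).
  by apply: (W z y); rewrite // 1?mulrC // addnC.
have const q : q \is a polyOver I' -> (size q <= 1)%N -> q.[y] = 1 -> False.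
  move=> /polyOverP qI /size1_polyC ->; rewrite hornerC => q1.
  by move/negP: I1; rewrite -q1; apply; apply: qI.
have [|sg1] := leqP (size g) 1; first by move=> /const; apply.
case Dh: (size h) => [|b].
  by move/eqP: Dh hz; rewrite size_poly_eq0 => /eqP->; rewrite horner0 => /eqP;
     rewrite eq_sym oner_eq0.
case Dg: (size g) sg1 => [//|a] a1; rewrite ltnS in a1.
have {IHn}IH q : q \is a polyOver I' -> (size q <= a)%N -> q.[y] = 1 -> False.
  move=> qI sq qy; apply: (IHn y z yz q h) => //.
  by rewrite -ltnS (leq_trans _ le_n) // ltnS Dg addSn ltnS leq_add2r.
have ba : (b <= a)%N by rewrite Dg Dh ltnS in le_hg.
have /polyOverP gIc := gI; have /polyOverP hIc := hI.
have B1 : 1 \in B by case: sB.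
have BB u v : u \in B -> v \in B -> u - v \in B by case: sB => _ + _; apply.
have BN u : u \in B -> - u \in B.
  by move=> Bu; rewrite -sub0r -(subrr 1) BB // BB.
pose g1 := \poly_(i < a) g`_i.
pose h1 : {poly N} := \sum_(j < b) h`_j.+1 *: 'X^(a - j.+1).
have gy1 : g.[y] = g1.[y] + g`_a * y ^+ a.
  by rewrite horner_coef Dg big_ord_recr horner_poly.
have hz1 : y ^+ a * (1 - h`_0) = h1.[y].
  rewrite -hz horner_coef Dh big_ord_recl expr0 mulr1 addrC addKr.
  rewrite mulr_sumr /h1 horner_sum; apply: eq_bigr => j _ /=.
  rewrite hornerZ hornerXn mulrCA; congr (_ * _).
  have ja : (j.+1 <= a)%N by apply: leq_trans ba; apply: ltn_ord.
  by rewrite -{1}(subnK ja) exprD -mulrA -exprMn yz expr1n mulr1.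
have IM u q : u \in B -> q \is a polyOver I' -> u *: q \is a polyOver I'.
  move=> Bu /polyOverP => qc; apply/polyOverP=> i; rewrite coefZ.
  by apply: BI => //; apply: qc.
have g1I : g1 \is a polyOver I'.
  by apply: polyOver_poly => i _; apply: gIc.
have h1I : g`_a *: h1 \is a polyOver I'.
  rewrite IM ?IB // rpred_sum // => j _.
  apply/polyOverP=> i; rewrite coefZ coefXn.
  by case: eqP; rewrite ?mulr1 ?mulr0 ?rpred0.
apply: (IH ((h`_0)%:P + (1 - h`_0) *: g1 + g`_a *: h1)).
- rewrite rpredD ?h1I // rpredD ?polyOverC ?hIc //.
  apply: IM => //; apply: BB => //; apply: IB; exact: hIc.
- rewrite !(leq_trans (size_polyD _ _)) // geq_max; apply/andP; split.
    rewrite (leq_trans (size_polyD _ _)) // geq_max.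
    rewrite (leq_trans (size_polyC_leq1 _)) //.
    by rewrite (leq_trans (size_scale_leq _ _)) // size_poly.
  rewrite (leq_trans (size_scale_leq _ _)) // (leq_trans (size_sum _ _ _)) //.
  apply/bigmax_leqP=> j _; rewrite (leq_trans (size_scale_leq _ _)) //.
  by rewrite size_polyXn subnSK ?leq_subr // (leq_trans _ ba).
- rewrite !hornerE /= -hz1.
  have -> : g1.[y] = 1 - g`_a * y ^+ a by rewrite -gy gy1 addrK.
  by ring.
Qed.

End Chevalley.

(** Chevalley's extension theorem. In a maximal proper pair above the image of
    O and of its maximal ideal, the subring contains x or its inverse:
    otherwise proper_pair_adjoin gives relations contradicting proper_pair_inv. *)
Theorem valsub_extension (N N' : fieldType) (f : {rmorphism N -> N'})
    (O : valsub N) :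
  exists O' : valsub N', forall x, (f x \in vsring O') = (x \in vsring O).
Proof.
pose B0 : N' -> bool := [pred y | `[< exists2 x, x \in vsring O & y = f x >]].
pose I0 : N' -> bool := [pred y | `[< exists2 x, x \in vsmax O & y = f x >]].
have B0P y : reflect (exists2 x, x \in vsring O & y = f x) (y \in B0).
  exact: asboolP.
have I0P y : reflect (exists2 x, x \in vsmax O & y = f x) (y \in I0).
  exact: asboolP.
have pp0 : proper_pair (B0, I0).
  split=> /=.
  - split=> [|_ _ /B0P[x Ox ->] /B0P[y Oy ->]|_ _ /B0P[x Ox ->] /B0P[y Oy ->]].
    + by apply/B0P; exists 1; rewrite ?rpred1 ?rmorph1.
    + by apply/B0P; exists (x - y); rewrite ?rpredB ?rmorphB.
    + by apply/B0P; exists (x * y); rewrite ?rpredM ?rmorphM.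
  - split=> [|_ _ /I0P[x mx ->] /I0P[y my ->]].
    + by apply/I0P; exists 0; rewrite ?rpred0 ?rmorph0.
    + by apply/I0P; exists (x - y); rewrite ?rpredB ?rmorphB.
  - by move=> _ /I0P[x mx ->]; apply/B0P; exists x; rewrite ?vsmaxW.
  - move=> _ _ /B0P[x Ox ->] /I0P[y my ->].
    by apply/I0P; exists (x * y); rewrite ?vsmaxM ?rmorphM.
  - apply/negP=> /I0P[x mx]; rewrite -(rmorph1 f) => /fmorph_inj x1.
    by move: mx; rewrite -x1 (negbTE (vsmax1 O)).
pose T := {X : (N' -> bool) * (N' -> bool) | proper_pair X /\ pair_le (B0, I0) X}.
have T0 : T by exists (B0, I0); split=> //; split.
pose R (s t : T) : bool := `[< pair_le (sval s) (sval t) >].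
have RP s t : reflect (pair_le (sval s) (sval t)) (R s t) by exact: asboolP.
have [|s r t /RP[rs1 rs2] /RP[st1 st2]|A totA|t maxX] :=
    @ZL_preorder T T0 R.
- by move=> t; apply/RP; split.
- by apply/RP; split=> x; [move/rs1/st1|move/rs2/st2].
- have [[s0 As0]|A0] := pselect (exists s, A s); last first.
    by exists T0 => s As; case: A0; exists s.
  have [||_ _ [s As <-] [t At <-]|Z ppZ leZ] :=
      @proper_pair_chain _ (fun X => exists2 s, A s & sval s = X) (sval s0).
  + by exists s0.
  + by move=> _ [s As <-]; case: (svalP s).
  + by have [/RP|/RP] := totA _ _ As At; [left|right].
  have le0Z : pair_le (B0, I0) Z.
    have [_ [le1 le2]] := svalP s0; have [|le3 le4] := leZ (sval s0).
      by exists s0.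
    by split=> x; [move/le1/le3|move/le2/le4].
  by exists (exist _ Z (conj ppZ le0Z)) => s As; apply/RP/leZ; exists s.
pose X := sval t; have [ppX le0X] : proper_pair X /\ pair_le (B0, I0) X := svalP t.
have adj y : y \notin X.1 ->
    exists2 g : {poly N'}, g \is a polyOver X.2 & g.[y] = 1.
  move=> Xy; apply: contrapT => /(proper_pair_adjoin ppX)[Y ppY [XY Yy]].
  have le0Y : pair_le (B0, I0) Y.
    by case: le0X XY => l1 l2 [l3 l4]; split=> x; [move/l1/l3|move/l2/l4].
  have /RP[/= YX _] : R (exist _ Y (conj ppY le0Y)) t.
    by apply: maxX; apply/RP.
  by move/negP: Xy; apply; apply: YX.
have tot y : (y \in X.1) || (y^-1 \in X.1).
  apply/norP=> -[/[dup] Xy /adj gy /adj gVy].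
  have y0 : y != 0.
    apply: contraNneq Xy => ->; apply: (pp_sub ppX).
    by case: (pp_zmod ppX).
  exact: (proper_pair_inv ppX (mulfV y0)).
exists (ValSub (pp_ring ppX) tot) => x.
case: le0X => l1 l2; apply/idP/idP => [fx|Ox]; last by apply: l1; apply/B0P; exists x.
apply: contraT => Ox.
have x0 : x != 0 by apply: contraNneq Ox => ->; apply: rpred0.
have mx : f x^-1 \in X.2.
  by apply: l2; apply/I0P; exists x^-1; rewrite // inE invrK Ox orbT.
have /negP[] := pp_proper ppX.
by rewrite -(rmorph1 f) -(mulfV x0) rmorphM (pp_mul ppX).
Qed.

(** * Splitting fields and Gauss valuations *)

Lemma irreducible_factor (F : fieldType) (f : {poly F}) : (1 < size f)%N ->
  exists2 g : {poly F}, irreducible_poly g & g %| f.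
Proof.
move=> sf.
have ex : exists n, `[< exists2 g : {poly F}, (1 < size g)%N && (g %| f) &
                        size g = n >].
  by exists (size f); apply/asboolP; exists f; rewrite ?sf ?dvdpp.
case: (ex_minnP ex) => n /asboolP[g /andP[sg gf] Dn] min_n.
exists g => //; split=> // h sh hg.
have hn0 : h != 0.
  apply: contraTneq hg => ->; rewrite dvd0p -size_poly_eq0 -lt0n.
  exact: ltnW.
have gn0 : g != 0 by rewrite -size_poly_eq0 -lt0n ltnW.
rewrite -dvdp_size_eqp // eqn_leq dvdp_leq //= Dn min_n //.
apply/asboolP; exists h => //; rewrite (dvdp_trans hg gf) andbT.
by rewrite ltn_neqAle eq_sym sh size_poly_gt0.
Qed.

Lemma root_extension (F : fieldType) (f : {poly F}) : (1 < size f)%N ->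
  exists (F' : fieldType) (e : {rmorphism F -> F'}) (x : F'),
    root (map_poly e f) x.
Proof.
move=> /irreducible_factor[g /irredp_FAdjoin[L _ [x gx _]] gf].
exists L, (in_alg L : {rmorphism F -> L}), x.
by move: gx; rewrite -!dvdp_XsubCl => /dvdp_trans; apply; rewrite dvdp_map.
Qed.

Lemma splitting_extension (F : fieldType) (f : {poly F}) : f \is monic ->
  exists (F' : fieldType) (e : {rmorphism F -> F'}) (rs : seq F'),
    map_poly e f = \prod_(r <- rs) ('X - r%:P).
Proof.
have [n] := ubnP (size f); elim: n => // n IHn in F f *; rewrite ltnS => sf fm.
have [sf1|sf1] := leqP (size f) 1.
  exists F, (idfun : {rmorphism F -> F}), [::]; rewrite big_nil map_poly_id //.
  move: fm; rewrite {1}(size1_polyC sf1) monicE lead_coefC => /eqP f0.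
  by rewrite (size1_polyC sf1) f0.
have [F1 [e1 [x /factor_theorem[g Dg]]]] := root_extension sf1.
have gm : g \is monic by rewrite -(monicMr _ (monicXsubC x)) -Dg map_monic.
have sg : (size g < n)%N.
  apply: leq_trans sf; rewrite -(size_map_poly e1 f) Dg.
  by rewrite size_Mmonic ?monicXsubC ?monic_neq0 // size_XsubC addn2.
have [F2 [e2 [rs Drs]]] := IHn _ _ sg gm.
exists F2, (e2 \o e1 : {rmorphism F -> F2}), (rcons rs (e2 x)).
rewrite map_poly_comp Dg rmorphM /= Drs map_polyXsubC.
by rewrite -cats1 big_cat big_seq1.
Qed.

Lemma valued_splitting (N : fieldType) (O : valsub N) (f : {poly N}) :
    f \is monic ->
  exists (N' : fieldType) (e : {rmorphism N -> N'}) (O' : valsub N')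
    (rs : seq N'), (forall x, (e x \in vsring O') = (x \in vsring O)) /\
      map_poly e f = \prod_(r <- rs) ('X - r%:P).
Proof.
move=> /splitting_extension[N' [e [rs Df]]].
by have [O' eO] := valsub_extension e O; exists N', e, O', rs.
Qed.

Section Primitive.
Variables (N : fieldType) (O : valsub N).
Implicit Types (f g h : {poly N}).

(** Primitive polynomials have Gauss value 0. *)
Definition primitive g :=
  (g \is a polyOver (vsring O)) && (g \isn't a polyOver (vsmax O)).

Lemma primitiveW g : primitive g -> g \is a polyOver (vsring O).
Proof. by case/andP. Qed.

Lemma polyOver_max g :
  reflect (forall i, g`_i \in vsmax O) (g \is a polyOver (vsmax O)).
Proof. exact: polyOverP. Qed.

Lemma primitiveP g : primitive g ->
  exists2 i, g`_i \in vsunit O & forall j, (j < i)%N -> g`_j \in vsmax O.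
Proof.
move=> /andP[gO gm].
have ex : exists i, g`_i \notin vsmax O.
  by apply: contrapT => gm'; move/negP: gm; apply; apply/polyOver_max => i;
     apply: contraT => gi; case: gm'; exists i.
case: (ex_minnP ex) => i gi min_i; exists i.
  by rewrite vsunit_max // (polyOverP gO).
by move=> j; rewrite ltnNge; apply: contraNT => gj; apply: min_i.
Qed.

Lemma primitive_coef g i :
  g \is a polyOver (vsring O) -> g`_i \in vsunit O -> primitive g.
Proof.
move=> gO; rewrite /primitive gO vsunitE => /andP[_] /=.
by apply: contra => /polyOver_max.
Qed.

(** The first unit coefficients of two primitive polynomials produce a unit
    coefficient of the product. *)
Lemma primitiveM g h : primitive g -> primitive h -> primitive (g * h).
Proof.
move=> pg ph; have gO := primitiveW pg; have hO := primitiveW ph.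
have [i gi min_i] := primitiveP pg; have [j hj min_j] := primitiveP ph.
apply: (@primitive_coef _ (i + j)); first by rewrite rpredM.
have ilt : (i < (i + j).+1)%N by rewrite ltnS leq_addr.
rewrite coefM (bigD1 (Ordinal ilt)) //= addKn vsunitD ?vsunitM //.
rewrite rpred_sum // => -[a a_lt] /=; rewrite -val_eqE /= => a_i.
have [ai|ia] := ltnP a i; first by rewrite vsmaxMl ?min_i ?(polyOverP hO).
have {}ia : (i < a)%N by rewrite ltn_neqAle eq_sym a_i.
rewrite vsmaxM ?(polyOverP gO) //; apply: min_j.
by rewrite ltn_subLR // ltn_add2r.
Qed.

Lemma primitive1 : primitive 1.
Proof.
by apply: (@primitive_coef _ 0); rewrite ?rpred1 // coef1 vsunit1.
Qed.

Lemma primitive_neq0 g : primitive g -> g != 0.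
Proof. by case/andP=> _; apply: contraNneq => ->; rewrite rpred0. Qed.

(** Divisibility by elements of O is a total preorder on N, so one of finitely
    many elements divides the others. *)
Lemma vs_max_coef n (u : nat -> N) i0 : (i0 < n)%N -> u i0 != 0 ->
  exists2 i, (i < n)%N && (u i != 0) &
    forall k, (k < n)%N -> u k / u i \in vsring O.
Proof.
elim: n i0 => // n IHn i0 i0n ui0.
have [un|un] := eqVneq (u n) 0.
  have {}i0n : (i0 < n)%N.
    by move: i0n; rewrite ltnS leq_eqVlt => /orP[/eqP Di|//];
       move: ui0; rewrite Di un eqxx.
  have [i /andP[i_n ui] uk] := IHn _ i0n ui0.
  exists i => [|k]; first by rewrite ui leqW.
  rewrite ltnS leq_eqVlt => /orP[/eqP ->|]; last exact: uk.
  by rewrite un mul0r rpred0.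
have [[j jn uj]|no] := pselect (exists2 j, (j < n)%N & u j != 0); last first.
  exists n => [|k]; first by rewrite leqnn un.
  rewrite ltnS leq_eqVlt => /orP[/eqP ->|kn]; first by rewrite divff ?rpred1.
  have [->|uk] := eqVneq (u k) 0; first by rewrite mul0r rpred0.
  by case: no; exists k.
have [i /andP[i_n ui] uk] := IHn _ jn uj.
have /orP[ni|] := vsP O (u n / u i).
  exists i => [|k]; first by rewrite ui leqW.
  by rewrite ltnS leq_eqVlt => /orP[/eqP ->|]; last exact: uk.
rewrite invf_div => in_; exists n => [|k]; first by rewrite leqnn un.
rewrite ltnS leq_eqVlt => /orP[/eqP ->|kn]; first by rewrite divff ?rpred1.
have -> : u k / u n = (u k / u i) * (u i / u n) by rewrite mulrA divfK.
by rewrite rpredM ?uk.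
Qed.

Lemma primitive_content g : g != 0 ->
  exists2 i, g`_i != 0 & primitive ((g`_i)^-1 *: g).
Proof.
move=> g0.
have sg : ((size g).-1 < size g)%N by rewrite prednK ?size_poly_gt0.
have lg : g`_(size g).-1 != 0 by rewrite -lead_coefE lead_coef_eq0.
have [i /andP[_ gi] gk] := vs_max_coef sg lg; exists i => //.
apply: (@primitive_coef _ i); last by rewrite coefZ mulVf ?vsunit1.
apply/polyOverP=> k; rewrite coefZ mulrC.
have [|kg] := ltnP k (size g); first exact: gk.
by rewrite nth_default // mul0r rpred0.
Qed.

End Primitive.

(** The Gauss valuation on a field of fractions of N[X]: its ring consists of
    the quotients of integral polynomials by primitive ones. *)
Lemma gauss_valsub (N : fieldType) (O : valsub N) (N' : fieldType)
    (F : {rmorphism {poly N} -> N'}) :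
    (forall g : {poly N}, g != 0 -> F g != 0) ->
    (forall x, exists n d : {poly N}, d != 0 /\ x = F n / F d) ->
  exists O' : valsub N',
    (forall x, (F x%:P \in vsring O') = (x \in vsring O)) /\
    forall g, primitive O g -> F g \in vsunit O'.
Proof.
move=> Finj Ffrac.
have F0 g : primitive O g -> F g != 0 by move=> /primitive_neq0 /Finj.
have e0 c : c != 0 -> F c%:P != 0 by move=> c0; rewrite Finj ?polyC_eq0.
have FZ c g : F (c *: g) = F c%:P * F g by rewrite -mul_polyC rmorphM.
pose O' : {pred N'} := [pred x | `[< exists g h,
  [/\ g \is a polyOver (vsring O), primitive O h & x = F g / F h] >]].
have O'P x : reflect (exists g h,
  [/\ g \is a polyOver (vsring O), primitive O h & x = F g / F h]) (x \in O').
  exact: asboolP.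
have sO' : subring_closed O'.
  split=> [|_ _ /O'P[g [h [gO hp ->]]] /O'P[g1 [h1 [gO1 hp1 ->]]]
           |_ _ /O'P[g [h [gO hp ->]]] /O'P[g1 [h1 [gO1 hp1 ->]]]].
  - apply/O'P; exists 1, 1; rewrite rpred1 rmorph1 divr1.
    by split=> //; apply: primitive1.
  - apply/O'P; exists (g * h1 - g1 * h), (h * h1).
    have hO := primitiveW hp; have hO1 := primitiveW hp1.
    rewrite primitiveM // rpredB ?rpredM //; split=> //.
    rewrite rmorphB !rmorphM mulrBl; congr (_ - _).
      by rewrite -mulf_div divff ?mulr1 ?F0.
    by rewrite [F h * _]mulrC -mulf_div divff ?mulr1 ?F0.
  - apply/O'P; exists (g * g1), (h * h1).
    rewrite primitiveM // rpredM //; split=> //.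
    by rewrite !rmorphM mulf_div.
have num x : x != 0 -> exists (c : N) g h,
    [/\ c != 0, primitive O g, primitive O h & x = F c%:P * (F g / F h)].
  move=> x0; have [n [d [d0 Dx]]] := Ffrac x.
  have n0 : n != 0 by apply: contraNneq x0 => n0; rewrite Dx n0 rmorph0 mul0r.
  have [i ni np] := primitive_content O n0.
  have [j dj dp] := primitive_content O d0.
  exists (n`_i / d`_j), ((n`_i)^-1 *: n), ((d`_j)^-1 *: d); split=> //.
    by rewrite mulf_neq0 ?invr_eq0.
  have Dn : n = n`_i *: ((n`_i)^-1 *: n) by rewrite scalerA mulfV ?scale1r.
  have Dd : d = d`_j *: ((d`_j)^-1 *: d) by rewrite scalerA mulfV ?scale1r.
  rewrite Dx {1}Dn {1}Dd !(FZ n`_i) !(FZ d`_j) invfM mulrACA; congr (_ * _).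
  apply: (mulIf (e0 _ dj)); rewrite divfK ?e0 // -rmorphM -polyCM.
  by rewrite divfK.
have Oc c g h : c \in vsring O -> primitive O g -> primitive O h ->
    F c%:P * (F g / F h) \in O'.
  move=> cO gp hp; apply/O'P; exists (c *: g), h; split=> //.
    by rewrite polyOverZ // primitiveW.
  by rewrite mulrA FZ.
have tO' x : (x \in O') || (x^-1 \in O').
  have [->|/num[c [g [h [c0 gp hp ->]]]]] := eqVneq x 0.
    by apply/orP; left; apply/O'P; exists 0, 1;
       rewrite rpred0 primitive1 rmorph0 mul0r.
  have /orP[cO|cO] := vsP O c; first by rewrite Oc.
  rewrite invfM invf_div; suff -> : (F c%:P)^-1 = F (c^-1)%:P by rewrite (Oc c^-1) ?orbT.
  by apply: (mulIf (e0 _ c0)); rewrite mulVf ?e0 // -rmorphM -polyCM mulVf ?rmorph1.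
exists (ValSub sO' tO'); split=> [x|g gp].
  apply/idP/idP => [/O'P[g [h [gO hp Dx]]]|xO]; last first.
    apply/O'P; exists x%:P, 1; rewrite polyOverC xO primitive1 rmorph1 divr1.
    by split.
  have {}Dx : x *: h = g.
    apply/eqP; rewrite -subr_eq0; apply: contraT => /Finj.
    by rewrite rmorphB FZ Dx divfK ?F0 // subrr eqxx.
  have [i hi _] := primitiveP hp.
  have := polyOverP gO i; rewrite -Dx coefZ => xh.
  rewrite -(mulfK (vsunit_neq0 hi) x) rpredM //.
  by rewrite vsunitW ?vsunitV.
rewrite inE F0 //=; apply/andP; split; apply/O'P.
  by exists g, 1; rewrite primitiveW ?primitive1 ?rmorph1 ?divr1.
by exists 1, g; rewrite rpred1 rmorph1 div1r.
Qed.

(** The representatives of fractions are pairs with nonzero denominator. *)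
Lemma fraction_quotient (R : idomainType) (x : {fraction R}) :
  exists n d : R,
    d != 0 /\ x = FracField.tofrac n / FracField.tofrac d.
Proof.
exists \n_(repr x), \d_(repr x); have nz_d := denom_ratioP (repr x).
have Fd0 : FracField.tofrac \d_(repr x) != 0 by rewrite tofrac_eq0.
split=> //; apply: (mulIf Fd0); rewrite divfK // -{1}[x]reprK.
move: (repr x) nz_d => {Fd0} y nz_d.
unlock FracField.tofrac; rewrite -[LHS]FracField.pi_mul.
apply/eqmodP; rewrite /= FracField.equivfE /FracField.mulf.
by rewrite !numden_Ratio ?mulr1 ?oner_eq0 // mulrC.
Qed.

Theorem gauss_extension (N : fieldType) (O : valsub N) :
  exists (N' : fieldType) (e : {rmorphism N -> N'}) (O' : valsub N') (t : N'),
    (forall x, (e x \in vsring O') = (x \in vsring O)) /\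
    forall g, primitive O g -> (map_poly e g).[t] \in vsunit O'.
Proof.
pose F : {rmorphism {poly N} -> {fraction {poly N}}} := @FracField.tofrac _.
have [||O' [eO Op]] := @gauss_valsub N O _ F.
- by move=> g; rewrite tofrac_eq0.
- exact: fraction_quotient.
exists {fraction {poly N}}, (F \o polyC : {rmorphism N -> {fraction {poly N}}}).
exists O', (F 'X); split=> // g /Op.
by rewrite map_poly_comp horner_map /= -/(g \Po 'X) comp_polyXr.
Qed.

(** * Simple roots generate immediate extensions *)

Section DominantRoot.
Variables (N : fieldType) (O : valsub N).

(** If no root has the value of z0, then after rescaling by z0 the roots
    of smaller value only contribute a constant and those of larger value
    only a power of X, up to the maximal ideal. *)
Lemma prod_monomial (z0 : N) (zs : seq N) : z0 != 0 ->
    (forall z, z \in zs -> z / z0 \notin vsunit O) ->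
  exists s C, forall k,
    C * (\prod_(z <- zs) ('X - z%:P))`_k * z0 ^+ k - (k == s)%:R \in vsmax O.
Proof.
move=> z00; elim: zs => [|z zs IHzs] zsU.
  exists 0%N, 1 => k; rewrite big_nil coef1 mul1r; case: eqP => [->|_].
    by rewrite expr0 mulr1 subrr rpred0.
  by rewrite mul0r subrr rpred0.
have [|s [C Ck]] := IHzs.
  by move=> y ys; apply: zsU; rewrite inE ys orbT.
have CO k : C * (\prod_(z <- zs) ('X - z%:P))`_k * z0 ^+ k \in vsring O.
  by rewrite -[X in X \in _](subrK (k == s)%:R) rpredD ?rpred_nat // vsmaxW.
have zU : z / z0 \notin vsunit O by apply: zsU; rewrite mem_head.
have step k : z0 ^+ k * ('X * \prod_(z <- zs) ('X - z%:P))`_k =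
    if k is k'.+1 then z0 * ((\prod_(z <- zs) ('X - z%:P))`_k' * z0 ^+ k')
    else 0.
  by rewrite coefXM; case: k => [|k] /=; rewrite ?mulr0 // exprS; ring.
have [zO|zO] := boolP (z / z0 \in vsring O).
  have zm : z / z0 \in vsmax O by rewrite -[_ \in _]negbK -vsunit_max.
  exists s.+1, (C / z0) => k; rewrite big_cons mulrBl coefB coefCM.
  set P := \prod_(z <- zs) _ in step CO Ck *.
  have -> : C / z0 * (('X * P)`_k - z * P`_k) * z0 ^+ k =
      C / z0 * (z0 ^+ k * ('X * P)`_k) - (z / z0) * (C * P`_k * z0 ^+ k).
    by field.
  rewrite step addrAC rpredB //; last by rewrite vsmaxMl.
  case: k => [|k]; first by rewrite mulr0 subr0 rpred0.
  have -> : C / z0 * (z0 * (P`_k * z0 ^+ k)) = C * P`_k * z0 ^+ k by field.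
  by rewrite eqSS Ck.
have z1 : z != 0 by apply: contraNneq zO => ->; rewrite mul0r rpred0.
have zm : z0 / z \in vsmax O.
  by rewrite inE invf_div zO orbT.
exists s, (- C / z) => k; rewrite big_cons mulrBl coefB coefCM.
set P := \prod_(z <- zs) _ in step CO Ck *.
have -> : - C / z * (('X * P)`_k - z * P`_k) * z0 ^+ k =
    C * P`_k * z0 ^+ k - C / z * (z0 ^+ k * ('X * P)`_k).
  by field.
rewrite step addrAC rpredB //; case: k => [|k]; first by rewrite mulr0 rpred0.
have -> : C / z * (z0 * (P`_k * z0 ^+ k)) = (z0 / z) * (C * P`_k * z0 ^+ k).
  by field.
by rewrite vsmaxMl.
Qed.

(** Multiplying the monomial of prod_monomial by X - z0 leaves two adjacent
    dominant coefficients, with quotient - z0. *)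
Lemma isolated_root_coef (z0 : N) (zs : seq N) : z0 != 0 ->
    (forall z, z \in zs -> z / z0 \notin vsunit O) ->
  let P := \prod_(z <- z0 :: zs) ('X - z%:P) in
  exists s, P`_s.+1 != 0 /\ (- P`_s / P`_s.+1) / z0 - 1 \in vsmax O.
Proof.
move=> z00 /(prod_monomial z00)[s [C Ck]]; rewrite big_cons.
set P := \prod_(z <- zs) _ in Ck *; set Q := _ * P.
have Qk k : C / z0 * Q`_k * z0 ^+ k =
    (if k is k'.+1 then C * P`_k' * z0 ^+ k' else 0) - C * P`_k * z0 ^+ k.
  rewrite /Q mulrBl coefB coefCM coefXM; case: k => [|k] /=.
    by field.
  by rewrite exprS; field.
pose a := C / z0 * Q`_s * z0 ^+ s; pose b := C / z0 * Q`_s.+1 * z0 ^+ s.+1.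
have am : a + 1 \in vsmax O.
  rewrite /a Qk; have := Ck s; rewrite eqxx -opprB => /vsmaxN.
  rewrite opprK => Cs; rewrite addrAC -addrA rpredD //.
  case: s Ck {Qk a b Cs} => [|s] Ck; first exact: rpred0.
  by have := Ck s; rewrite -[s == _]negbK neq_ltn ltnSn subr0.
have bm : b - 1 \in vsmax O.
  rewrite /b Qk addrAC rpredB //; first by have := Ck s; rewrite eqxx.
  by have := Ck s.+1; rewrite -[_ == _]negbK neq_ltn ltnSn orbT subr0.
have bU : b \in vsunit O.
  by rewrite -(subrK 1 b) addrC vsunitD ?vsunit1.
have b0 := vsunit_neq0 bU; exists s; split=> /=.
  by apply: contraNneq b0 => Q0; rewrite /b Q0 mulr0 mul0r.
have -> : - Q`_s / Q`_s.+1 / z0 = - a / b.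
  have : C / z0 != 0 by apply: contraNneq b0 => C0; rewrite /b C0 !mul0r.
  have : Q`_s.+1 != 0 by apply: contraNneq b0 => Q0; rewrite /b Q0 mulr0 mul0r.
  rewrite mulf_eq0 invr_eq0 negb_or => Q0 /andP[C0 _].
  have z0s : z0 ^+ s != 0 by rewrite expf_neq0.
  by rewrite /a /b exprS; field; rewrite Q0 C0 z0s z00.
have -> : - a / b - 1 = - ((a + 1) + (b - 1)) / b by field.
by apply: vsmaxMl; [rewrite rpredN rpredD|rewrite vsunitW ?vsunitV].
Qed.

End DominantRoot.

(** The polynomial with roots h(a), for a ranging over the roots of f, is the
    characteristic polynomial of the multiplication by h modulo f; it is
    computed by conjugating that matrix with a Vandermonde matrix. *)
Lemma norm_poly (L N : fieldType) (e : {rmorphism L -> N}) (f h : {poly L})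
    (rs : seq N) :
    f \is monic -> map_poly e f = \prod_(r <- rs) ('X - r%:P) -> uniq rs ->
  exists P : {poly L},
    map_poly e P = \prod_(r <- rs) ('X - ((map_poly e h).[r])%:P).
Proof.
move=> fm Df Urs; set n := size rs.
pose a : 'rV[N]_n := \row_j rs`_j.
pose V := Vandermonde n a.
pose A : 'M[L]_n := \matrix_(i, l) (('X^i * h) %% f)`_l.
pose D : 'rV[N]_n := \row_j (map_poly e h).[a 0 j].
have sf : size f = n.+1.
  by rewrite -(size_map_poly e) Df size_prod_XsubC.
have fa j : (map_poly e f).[a 0 j] = 0.
  by apply/eqP; rewrite Df -/(root _ _) root_prod_XsubC mxE mem_nth.
have AV : map_mx e A *m V = V *m diag_mx D.
  apply/matrixP=> i j; rewrite mul_mx_diag !mxE.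
  transitivity (map_poly e (('X^i * h) %% f)).[a 0 j].
    rewrite (@horner_coef_wide _ n); last first.
      by rewrite size_map_poly -ltnS -sf ltn_modp -size_poly_eq0 sf.
    by apply: eq_bigr => l _; rewrite !mxE coef_map.
  transitivity (map_poly e ('X^i * h)).[a 0 j].
    rewrite {2}(divp_eq ('X^i * h) f) rmorphD rmorphM hornerD hornerM fa.
    by rewrite mulr0 add0r.
  by rewrite rmorphM hornerM /= map_polyXn hornerXn !mxE.
have V0 : \det V != 0.
  rewrite det_Vandermonde; apply/prodf_neq0 => i _; apply/prodf_neq0 => j ij.
  rewrite subr_eq0 !mxE nth_uniq //.
  by apply/eqP=> ji; move: ij; rewrite ji ltnn.
exists (char_poly A); rewrite map_char_poly.
transitivity (char_poly (diag_mx D)); last first.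
  rewrite char_poly_trig // (big_nth 0) big_mkord; apply: eq_bigr => i _.
  by rewrite !mxE eqxx.
have : \det (char_poly_mx (map_mx e A)) * \det (map_mx polyC V) =
       \det (map_mx polyC V) * \det (char_poly_mx (diag_mx D)).
  rewrite -!det_mulmx; congr (\det _).
  by rewrite mulmxBl mulmxBr -!map_mxM AV scalar_mxC.
rewrite [RHS]mulrC; apply: mulIf.
by rewrite det_map_mx polyC_eq0.
Qed.

(** Let a be an approximation in L of the root r0 of f, no other root of f
    being congruent to a. Multiplying h by a large power of X - a
    isolates the value at r0 among the values at the roots of f, because only
    r0 - a is not a unit. *)
Lemma simple_root_immediate (L N : fieldType) (e : {rmorphism L -> N})
    (O : valsub N) (f : {poly L}) (r0 : N) (rs : seq N) (a : L) :
    f \is monic -> map_poly e f = \prod_(r <- r0 :: rs) ('X - r%:P) ->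
    uniq (r0 :: rs) -> r0 - e a \in vsmax O ->
    (forall r, r \in rs -> r - e a \in vsunit O) ->
  forall h : {poly L}, (map_poly e h).[r0] != 0 ->
  exists c, e c / (map_poly e h).[r0] - 1 \in vsmax O.
Proof.
move=> fm Df Urs r0m rsU h hr0.
have [r0a|r0a] := eqVneq (r0 - e a) 0.
  exists h.[a]; rewrite -horner_map; move/eqP: r0a.
  by rewrite subr_eq0 => /eqP <-; rewrite divff // subrr rpred0.
have isolate (g : {poly L}) : (map_poly e g).[r0] != 0 ->
    exists s0, forall s, (s0 <= s)%N -> exists c,
      c != 0 /\ e c / ((map_poly e g).[r0] * (r0 - e a) ^+ s) - 1 \in vsmax O.
  move=> gr0; pose v s (r : N) := (map_poly e g).[r] * (r - e a) ^+ s.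
  have v0 s : v s r0 != 0 by rewrite mulf_neq0 ?expf_neq0.
  have one r : r \in rs ->
      exists s0, forall s, (s0 <= s)%N -> v s r / v s r0 \notin vsunit O.
    move=> /rsU rU.
    have [[s1 s1U]|no] := pselect (exists s, v s r / v s r0 \in vsunit O);
      last by exists 0%N => s _; apply/negP=> sU; case: no; exists s.
    exists s1.+1 => s s1s; apply/negP=> sU.
    have D : v s r / v s r0 =
        (v s1 r / v s1 r0) * ((r - e a) / (r0 - e a)) ^+ (s - s1).
      rewrite /v -{1 2}(subnKC (ltnW s1s)) !exprD expr_div_n.
      by field; rewrite ?r0a ?gr0 ?expf_neq0.
    have : ((r - e a) / (r0 - e a)) ^+ (s - s1) \in vsunit O.
      rewrite -(mulKf (vsunit_neq0 s1U) (_ ^+ _)) -D.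
      by rewrite vsunitM ?vsunitV.
    rewrite -subn_gt0 in s1s => /(vsunit_root s1s) qU.
    suff : r0 - e a \in vsunit O by rewrite vsunitE r0m andbF.
    have -> : r0 - e a = (r - e a) / ((r - e a) / (r0 - e a)).
      by rewrite invf_div mulrC divfK ?(vsunit_neq0 rU).
    by rewrite vsunitM ?vsunitV.
  have [s0 s0P] : exists s0, forall s, (s0 <= s)%N ->
      forall r, r \in rs -> v s r / v s r0 \notin vsunit O.
    elim: (rs) one => [|r rs' IH] one; first by exists 0%N.
    have [s1 s1P] := one r (mem_head _ _).
    have [|s2 s2P] := IH.
      by move=> r' r'rs; apply: one; rewrite inE r'rs orbT.
    exists (maxn s1 s2) => s; rewrite geq_max => /andP[ss1 ss2] r'.
    by rewrite inE => /orP[/eqP->|]; [apply: s1P|apply: s2P].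
  exists s0 => s /s0P sP.
  pose g1 := g * ('X - a%:P) ^+ s.
  have g1E r : (map_poly e g1).[r] = v s r.
    by rewrite rmorphM rmorphXn /= map_polyXsubC !hornerE.
  have [P DP] := norm_poly g1 fm Df Urs.
  have [|y /mapP[r rrs ->]|i [Pi0 Pi]] :=
      @isolated_root_coef _ O (v s r0) [seq v s r | r <- rs].
  - exact: v0.
  - exact: sP.
  have PE : map_poly e P =
      \prod_(z <- v s r0 :: [seq v s r | r <- rs]) ('X - z%:P).
    rewrite DP -map_cons big_map; apply: eq_bigr => r _.
    by rewrite g1E.
  rewrite -PE !coef_map fmorph_eq0 in Pi0 Pi.
  rewrite -fmorphV -rmorphN -rmorphM in Pi.
  exists (- P`_i / P`_i.+1); split=> //.
  apply/eqP=> c0; rewrite c0 rmorph0 mul0r sub0r in Pi.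
  by have := vsmaxN Pi; rewrite opprK (negbTE (vsmax1 O)).
have [s1 s1P] := isolate _ hr0.
have [|s2 s2P] := isolate 1; first by rewrite rmorph1 hornerC oner_eq0.
have [c1 [c10 c1P]] := s1P _ (leq_maxl s1 s2).
have [c2 [c20 c2P]] := s2P _ (leq_maxr s1 s2).
exists (c1 / c2).
move: c1P c2P; rewrite rmorph1 hornerC mul1r.
set d := _ ^+ _; set x := _.[r0] in hr0 *; set u := _ / (x * d); set w := _ / d.
have d0 : d != 0 by rewrite expf_neq0.
have ec1 : e c1 != 0 by rewrite fmorph_eq0.
have ec2 : e c2 != 0 by rewrite fmorph_eq0.
move=> um wm; have wU : w \in vsunit O.
  by rewrite -(subrK 1 w) addrC vsunitD ?vsunit1.
have -> : e (c1 / c2) / x - 1 = ((u - 1) - (w - 1)) / w.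
  rewrite fmorph_div /u /w; field; rewrite ?ec2 ?d0 ?hr0 //.
by apply: vsmaxMl; [rewrite rpredB|rewrite vsunitW ?vsunitV].
Qed.

(** * Terms and models *)

Section Models.
Variables (K : fieldType) (OK : valsub K) (k E : fieldType).
Variables (kK : {rmorphism k -> K}) (kE : {rmorphism k -> E}) (p : nat).

(** Formal expressions in elements of K and E, the notation E standing for k'.
    They give names, in a fixed type, to the elements of the fields that extend
    both. *)
Inductive term :=
  | TK of K
  | TE of E
  | TAdd of term & term
  | TMul of term & term
  | TOpp of term
  | TInv of term.

Fixpoint eval (N : fieldType) (i : K -> N) (j : E -> N) (t : term) : N :=
  match t with
  | TK x => i x
  | TE b => j b
  | TAdd s t => eval i j s + eval i j t
  | TMul s t => eval i j s * eval i j t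
  | TOpp t => - eval i j t
  | TInv t => (eval i j t)^-1
  end.

Fixpoint term_over (S : E -> bool) (t : term) : bool :=
  match t with
  | TK _ => true
  | TE b => S b
  | TAdd s t | TMul s t => term_over S s && term_over S t
  | TOpp t | TInv t => term_over S t
  end.

(** Inverses are excluded: these terms denote elements of the ring generated by
    the integers of K and the constants in E. *)
Fixpoint integral_term (t : term) : bool :=
  match t with
  | TK x => x \in vsring OK
  | TE b => true
  | TAdd s t | TMul s t => integral_term s && integral_term t
  | TOpp t => integral_term t
  | TInv t => false
  end.

Definition texp (t : term) (n : nat) := iter n (TMul t) (TK 1).

Lemma term_over_texp S t n : term_over S t -> term_over S (texp t n).
Proof. by move=> St; elim: n => //= n ->; rewrite St. Qed.

Lemma integral_texp t n : integral_term t -> integral_term (texp t n).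
Proof.
by move=> it; elim: n => [|n /= ->]; rewrite /= ?rpred1 ?it.
Qed.

Lemma eval_texp (N : fieldType) (i : {rmorphism K -> N}) j t n :
  eval i j (texp t n) = eval i j t ^+ n.
Proof. by elim: n => [|n /= ->]; rewrite ?expr0 ?exprS //= rmorph1. Qed.

Lemma term_over_sub (S S' : E -> bool) t :
  (forall b, S b -> S' b) -> term_over S t -> term_over S' t.
Proof.
move=> SS'; elim: t => //= s IHs t IHt.
  by move=> /andP[/IHs-> /IHt->].
by move=> /andP[/IHs-> /IHt->].
Qed.

Section Conditions.
Variables (N : fieldType) (O : valsub N) (i : {rmorphism K -> N}).
Variables (S : E -> bool) (j : E -> N).

(** The value of x is a p-power root of the value of an element of K. *)
Definition value_over (x : N) :=
  exists n c, x ^+ (p ^ n) / i c \in vsunit O.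

(** The residue of some x^(p^n) is the quotient b/s of residues of integral
    terms. *)
Definition residue_over (x : N) :=
  exists n b s, [/\ integral_term b && integral_term s,
    term_over S b && term_over S s, eval i j s \in vsunit O
    & eval i j s * x ^+ (p ^ n) - eval i j b \in vsmax O].

End Conditions.

(** The field of constants mdom is a part of E, and mE is a homomorphism on it
    only; the two conditions on values and residues concern the elements
    denoted by terms, not the whole field mfield, which may be larger. *)
Record model := Model {
  mfield : fieldType;
  mring : valsub mfield;
  mK : {rmorphism K -> mfield};
  mdom : E -> bool;
  mE : E -> mfield;
  mdom_closed : divring_closed (mdom : {pred E});
  mE1 : mE 1 = 1;
  mEB : forall x y, mdom x -> mdom y -> mE (x - y) = mE x - mE y;
  mEM : forall x y, mdom x -> mdom y -> mE (x * y) = mE x * mE y;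
  mdomk : forall a, mdom (kE a);
  mEk : forall a, mE (kE a) = mK (kK a);
  mringK : forall x, (mK x \in vsring mring) = (x \in vsring OK);
  mringE : forall b, mdom b -> mE b \in vsring mring;
  mvalue : forall t, term_over mdom t -> eval mK mE t != 0 ->
    value_over mring mK (eval mK mE t);
  mresidue : forall t, term_over mdom t -> eval mK mE t \in vsring mring ->
    residue_over mring mK mdom mE (eval mK mE t)
}.

Definition mval (M : model) := eval (mK M) (mE M).

(** What determines the valued subfield of elements denoted by terms: models
    involve arbitrary fields and are too many to be ordered in one type, but
    their shapes are not. *)
Definition shape (M : model) : (E -> bool) * (term -> bool) * (term -> bool) :=
  (mdom M, fun t => mval M t == 0, fun t => mval M t \in vsring (mring M)).

Definition shape_le (X Y : (E -> bool) * (term -> bool) * (term -> bool)) :=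
  (forall b, X.1.1 b -> Y.1.1 b) /\
  forall t, term_over X.1.1 t -> Y.1.2 t = X.1.2 t /\ Y.2 t = X.2 t.

Definition model_le (M M' : model) := shape_le (shape M) (shape M').

Lemma shape_le_refl X : shape_le X X.
Proof. by split. Qed.

Lemma shape_le_trans Y X Z : shape_le X Y -> shape_le Y Z -> shape_le X Z.
Proof.
move=> [XY1 XY2] [YZ1 YZ2]; split=> [b /XY1/YZ1 //|t Xt].
have [-> ->] := YZ2 t (term_over_sub XY1 Xt).
exact: XY2.
Qed.

(** The closure properties of value_over, and below of residue_over, by which
    these conditions propagate from a model to an extension. *)
Definition value_closed (N : fieldType) (O : valsub N) (Q : N -> Prop) :=
  [/\ forall x, x \in vsunit O -> Q x,
      forall x y, Q x -> Q y -> Q (x * y),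
      forall x, Q x -> Q x^-1
    & forall x, x != 0 -> Q (x ^+ p) -> Q x].

Definition residue_closed (N : fieldType) (O : valsub N) (R : N -> Prop) :=
  [/\ R 1,
      forall x, x \in vsmax O -> R x,
      (forall x y, R x -> R y -> R (x + y)) /\ (forall x, R x -> R (- x)),
      (forall x y, R x -> R y -> R (x * y)) /\
      (forall x, x \in vsunit O -> R x -> R x^-1)
    & forall x, x \in vsring O -> R (x ^+ p) -> R x].

Hypothesis hp : char_exponent k p.

Lemma char_exponent_gt0 : (0 < p)%N.
Proof. by case: hp => [/pcharf_prime/prime_gt0|[->]]. Qed.

Lemma char_exponent_nat (N : fieldType) (f : {rmorphism k -> N}) n :
  [pchar N].-nat (p ^ n)%N.
Proof.
case: hp => [pk|[-> _]]; last by rewrite exp1n.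
have pN : p \in [pchar N] by rewrite (fmorph_pchar f).
by rewrite pnatX pnatE ?pN // (pcharf_prime pk).
Qed.

Section Closures.
Variables (N : fieldType) (O : valsub N) (i : {rmorphism K -> N}).
Variables (S : E -> bool) (j : E -> N).
Hypothesis iO : forall x, (i x \in vsring O) = (x \in vsring OK).
Hypothesis jO : forall b, S b -> j b \in vsring O.

Local Notation ev := (eval i j).

Let pnat n : [pchar N].-nat (p ^ n)%N.
Proof. exact: (@char_exponent_nat N (i \o kK)). Qed.

Lemma integral_eval t : integral_term t -> term_over S t ->
  ev t \in vsring O.
Proof.
elim: t => //= [x|b _ /jO //|s IHs t IHt|s IHs t IHt|t IHt].
- by rewrite iO.
- by move=> /andP[/IHs{}IHs /IHt{}IHt] /andP[/IHs ? /IHt ?]; rewrite rpredD.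
- by move=> /andP[/IHs{}IHs /IHt{}IHt] /andP[/IHs ? /IHt ?]; rewrite rpredM.
- by move=> /IHt{}IHt /IHt ?; rewrite rpredN.
Qed.

Lemma value_over_lift x n c m : x ^+ (p ^ n) / i c \in vsunit O ->
  x ^+ (p ^ (n + m)) / i (c ^+ (p ^ m)) \in vsunit O.
Proof.
by move=> xc; rewrite expnD exprM rmorphXn -expr_div_n vsunitX.
Qed.

Lemma value_over_closed : value_closed O (value_over O i).
Proof.
split.
- by move=> x xU; exists 0%N, 1; rewrite rmorph1 divr1 expn0 expr1.
- move=> x y [n [c xc]] [m [d yd]]; exists (n + m)%N.
  exists (c ^+ (p ^ m) * d ^+ (p ^ n)); rewrite exprMn rmorphM.
  rewrite -mulf_div vsunitM ?value_over_lift //.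
  by rewrite addnC value_over_lift.
- move=> x [n [c xc]]; exists n, c^-1.
  by rewrite fmorphV exprVn -invfM vsunitVE.
- move=> x _ [n [c xc]]; exists n.+1, c.
  by rewrite expnS exprM.
Qed.

Lemma value_over_K c : c != 0 -> value_over O i (i c).
Proof.
by move=> c0; exists 0%N, c; rewrite expn0 expr1 divff ?fmorph_eq0 ?vsunit1.
Qed.

Local Notation res := (residue_over O i S j).

Lemma residue_over_lift x n b s m : integral_term b && integral_term s ->
    term_over S b && term_over S s -> ev s \in vsunit O ->
    ev s * x ^+ (p ^ n) - ev b \in vsmax O ->
  exists b' s', [/\ integral_term b' && integral_term s',
    term_over S b' && term_over S s', ev s' \in vsunit O
    & ev s' * x ^+ (p ^ (n + m)) - ev b' \in vsmax O].
Proof.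
move=> /andP[ib is_] /andP[ob os] sU xb.
exists (texp b (p ^ m)), (texp s (p ^ m)).
rewrite !integral_texp // !term_over_texp // !eval_texp vsunitX //.
split=> //; rewrite expnD exprM -exprMn -exprNn_pchar // -exprDn_pchar //.
have : (0 < p ^ m)%N by rewrite expn_gt0 char_exponent_gt0.
case: (p ^ m)%N => // r _; rewrite exprS vsmaxMl // rpredX //.
by rewrite vsmaxW.
Qed.

Lemma residue_over_int b : integral_term b -> term_over S b -> res (ev b).
Proof.
move=> ib ob; exists 0%N, b, (TK 1); split=> /=.
- by rewrite ib rpred1.
- by rewrite ob.
- by rewrite rmorph1 vsunit1.
- by rewrite rmorph1 mul1r expn0 expr1 subrr rpred0.
Qed.

Lemma residue_over_max x : x \in vsmax O -> res x.
Proof.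
move=> xm; exists 0%N, (TK 0), (TK 1); split=> //=.
- by rewrite rpred0 rpred1.
- by rewrite rmorph1 vsunit1.
- by rewrite rmorph1 rmorph0 subr0 mul1r expn0 expr1.
Qed.

Lemma residue_over_ring x : res x -> x \in vsring O.
Proof.
move=> [n [b [s [/andP[ib _] /andP[ob _] sU xb]]]].
have : x ^+ (p ^ n) \in vsring O.
  rewrite -(mulKf (vsunit_neq0 sU) (x ^+ _)) rpredM //.
    by rewrite vsunitW ?vsunitV.
  by rewrite -[_ * _](subrK (ev b)) rpredD ?integral_eval // vsmaxW.
by apply: vs_root; rewrite expn_gt0 char_exponent_gt0.
Qed.

(** After raising to powers of p, two elements have a common exponent n; the
    Frobenius map being additive, the congruences can then be added. *)
Lemma residue_over_closed : residue_closed O res.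
Proof.
have common x y : res x -> res y -> exists n b s d t,
    [/\ [&& integral_term b, integral_term s, integral_term d
          & integral_term t],
        [&& term_over S b, term_over S s, term_over S d & term_over S t],
        ev s \in vsunit O /\ ev t \in vsunit O
      & ev s * x ^+ (p ^ n) - ev b \in vsmax O /\
        ev t * y ^+ (p ^ n) - ev d \in vsmax O].
  move=> [n [b [s [i1 o1 u1 m1]]]] [m [d [t [i2 o2 u2 m2]]]].
  have [b' [s' [/andP[i3 i3'] /andP[o3 o3'] u3 m3]]] :=
    residue_over_lift m i1 o1 u1 m1.
  have [d' [t' [/andP[i4 i4'] /andP[o4 o4'] u4]]] :=
    residue_over_lift n i2 o2 u2 m2.
  rewrite addnC => m4; exists (n + m)%N, b', s', d', t'.
  by split=> //; apply/and4P.
have ringS x := @residue_over_ring x.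
split.
- have := @residue_over_int (TK 1); rewrite /= rmorph1; apply=> //.
  exact: rpred1.
- exact: residue_over_max.
- split=> [x y xr yr|x [n [b [s [/andP[ib is_] /andP[ob os] sU xb]]]]].
    have [n [b [s [d [t [/and4P[i1 i2 i3 i4] /and4P[o1 o2 o3 o4]]]]]]] :=
      common x y xr yr.
    move=> [sU tU] [xb yd].
    exists n, (TAdd (TMul t b) (TMul s d)), (TMul s t) => /=.
    rewrite i1 i2 i3 i4 o1 o2 o3 o4; split=> //; first by rewrite vsunitM.
    rewrite exprDn_pchar //.
    have -> : forall X Y B D s' t' : N, s' * t' * (X + Y) - (t' * B + s' * D) =
       t' * (s' * X - B) + s' * (t' * Y - D) by move=> *; ring.
    by rewrite rpredD // vsmaxM // vsunitW.
  exists n, (TOpp b), s; rewrite /= ib is_ ob os; split=> //.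
  by rewrite exprNn_pchar // mulrN -opprD rpredN.
- split=> [x y xr yr|x xU [n [b [s [/andP[ib is_] /andP[ob os] sU xb]]]]].
    have xO := residue_over_ring xr; have yO := residue_over_ring yr.
    have [n [b [s [d [t [/and4P[i1 i2 i3 i4] /and4P[o1 o2 o3 o4]]]]]]] :=
      common x y xr yr.
    move=> [sU tU] [xb yd].
    exists n, (TMul b d), (TMul s t) => /=.
    rewrite i1 i2 i3 i4 o1 o2 o3 o4; split=> //; first by rewrite vsunitM.
    rewrite exprMn.
    have -> : forall X Y B D s' t' : N, s' * t' * (X * Y) - B * D =
       (t' * Y) * (s' * X - B) + B * (t' * Y - D) by move=> *; ring.
    apply: rpredD; apply: vsmaxM => //; last exact: integral_eval.
    by apply: rpredM; [exact: vsunitW|exact: rpredX].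
  have bU : ev b \in vsunit O.
    by apply: vsunit_cong xb; rewrite vsunitM // vsunitX.
  exists n, s, b; rewrite /= ib is_ ob os; split=> //.
  have -> : ev b * x^-1 ^+ (p ^ n) - ev s =
            - x^-1 ^+ (p ^ n) * (ev s * x ^+ (p ^ n) - ev b).
    rewrite exprVn mulNr mulrBr mulrCA mulVf ?expf_neq0 ?(vsunit_neq0 xU) //.
    by rewrite mulr1 opprB mulrC.
  by apply: vsmaxM => //; rewrite rpredN rpredX ?vsunitW ?vsunitV.
- move=> x _ [n [b [s [ibs obs sU xb]]]]; exists n.+1, b, s.
  by rewrite expnS exprM.
Qed.

End Closures.

End Models.

(** * The union of a chain of models *)

HB.instance Definition _ (K E : fieldType) := gen_eqMixin (term K E).
HB.instance Definition _ (K E : fieldType) := gen_choiceMixin (term K E).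

(** A is a chain of models. The elements of its union are the terms over
    the constants of some member of A, up to equality of their values there. *)
Section Limit.
Variables (K : fieldType) (OK : valsub K) (k E : fieldType).
Variables (kK : {rmorphism k -> K}) (kE : {rmorphism k -> E}) (p : nat).
Local Notation model := (model OK kK kE p).
Variables (A : model -> Prop).
Hypothesis A_total : forall M M', A M -> A M' ->
  model_le M M' \/ model_le M' M.

Local Notation over M t := (term_over (@mdom _ _ _ _ _ _ _ M) t).

Lemma model_le_eval (M M' : model) (s t : term K E) : model_le M M' ->
  over M s -> over M t -> mval M s = mval M t <-> mval M' s = mval M' t.
Proof.
move=> [_ le] os ot; have ost : over M (TAdd s (TOpp t)) by rewrite /= os ot.
have [/= D _] := le _ ost; rewrite /mval /= in D.
have eqE (N : fieldType) (x y : N) : x = y <-> x - y == 0.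
  by rewrite subr_eq0; split=> [->|/eqP].
by split=> /eqE; rewrite /mval => st; apply/eqE; rewrite ?D // -D.
Qed.

Definition limterm :=
  {t : term K E | `[< exists2 M, A M & over M t >]}.
HB.instance Definition _ := Choice.on limterm.

Definition limterm_of t (h : `[< exists2 M, A M & over M t >]) : limterm :=
  exist _ t h.

Lemma limtermP (t : limterm) : exists2 M, A M & over M (val t).
Proof. exact/asboolP/(valP t). Qed.

Lemma over_le (M M' : model) (t : term K E) : model_le M M' -> over M t -> over M' t.
Proof. by move=> [SS _]; apply: term_over_sub. Qed.

Lemma common2 M M' : A M -> A M' ->
  exists N, [/\ A N, model_le M N & model_le M' N].
Proof.
move=> AM AM'; have [le|le] := A_total AM AM'.
  by exists M'; split=> //; apply: shape_le_refl.
by exists M; split=> //; apply: shape_le_refl.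
Qed.

Lemma common3 (s t u : limterm) :
  exists M, [/\ A M, over M (val s), over M (val t) & over M (val u)].
Proof.
have [M1 A1 o1] := limtermP s; have [M2 A2 o2] := limtermP t.
have [M3 A3 o3] := limtermP u; have [M4 [A4 le14 le24]] := common2 A1 A2.
have [M [AM le4 le3]] := common2 A4 A3; exists M; split=> //.
- exact: over_le le4 (over_le le14 o1).
- exact: over_le le4 (over_le le24 o2).
- exact: over_le le3 o3.
Qed.

Definition limeq (s t : limterm) : bool :=
  `[< exists M, [/\ A M, over M (val s), over M (val t) &
                    mval M (val s) = mval M (val t)] >].

Lemma limeqP s t : reflect (exists M, [/\ A M, over M (val s), over M (val t) &
  mval M (val s) = mval M (val t)]) (limeq s t).
Proof. exact: asboolP. Qed.

(** Equality in the union can be tested in any model that contains both terms. *)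
Lemma limeqE M s t : A M -> over M (val s) -> over M (val t) ->
  limeq s t -> mval M (val s) = mval M (val t).
Proof.
move=> AM os ot /limeqP[M' [AM' os' ot' st]].
have [N [AN le le']] := common2 AM AM'.
by apply/(model_le_eval le os ot)/(model_le_eval le' os' ot').
Qed.

Lemma limeq_refl : reflexive limeq.
Proof. by move=> t; have [M AM ot] := limtermP t; apply/limeqP; exists M. Qed.

Lemma limeq_sym : symmetric limeq.
Proof.
by move=> s t; apply/limeqP/limeqP=> -[M [? ? ? ?]]; exists M; split.
Qed.

Lemma limeq_trans : transitive limeq.
Proof.
move=> t s u st tu; have [M [AM os ot ou]] := common3 s t u.
by apply/limeqP; exists M; split=> //; rewrite (limeqE AM os ot) ?(limeqE AM ot ou).
Qed.

Definition limeq_equiv := EquivRel limeq limeq_refl limeq_sym limeq_trans.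
Definition limfield := {eq_quot limeq_equiv}.
HB.instance Definition _ := Choice.on limfield.
HB.instance Definition _ := EqQuotient.on limfield.

Definition lim (t : limterm) : limfield := \pi_limfield t.

Lemma lim_eq s t : (lim s = lim t) <-> limeq s t.
Proof. by split=> [/eqmodP|st]; last exact/eqmodP. Qed.

Lemma limW (P : limfield -> Prop) : (forall t, P (lim t)) -> forall x, P x.
Proof. by move=> Pt x; rewrite -[x]reprK; apply: Pt. Qed.

Lemma lim_eqP s t : (exists M, [/\ A M, over M (val s), over M (val t) &
  mval M (val s) = mval M (val t)]) -> lim s = lim t.
Proof. by move=> /limeqP /lim_eq. Qed.

Lemma add_subproof (s t : limterm) :
  `[< exists2 M, A M & over M (TAdd (val s) (val t)) >].
Proof.
by have [M [AM os ot _]] := common3 s t t; apply/asboolP; exists M => //=;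
   rewrite os ot.
Qed.
Lemma mul_subproof (s t : limterm) :
  `[< exists2 M, A M & over M (TMul (val s) (val t)) >].
Proof. exact: add_subproof. Qed.
Lemma opp_subproof (t : limterm) :
  `[< exists2 M, A M & over M (TOpp (val t)) >].
Proof. exact: valP t. Qed.
Lemma inv_subproof (t : limterm) :
  `[< exists2 M, A M & over M (TInv (val t)) >].
Proof. exact: valP t. Qed.

Definition ladd s t : limterm := limterm_of (add_subproof s t).
Definition lmul s t : limterm := limterm_of (mul_subproof s t).
Definition lopp t : limterm := limterm_of (opp_subproof t).
Definition linv t : limterm := limterm_of (inv_subproof t).

Definition lim_add (x y : limfield) := lim (ladd (repr x) (repr y)).
Definition lim_mul (x y : limfield) := lim (lmul (repr x) (repr y)).
Definition lim_opp (x : limfield) := lim (lopp (repr x)).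
Definition lim_inv (x : limfield) := lim (linv (repr x)).

Lemma repr_lim t : limeq (repr (lim t)) t.
Proof. by apply/lim_eq; rewrite /lim reprK. Qed.

Lemma common4 (s t u v : limterm) :
  exists M, [/\ A M, over M (val s) && over M (val t)
    & over M (val u) && over M (val v)].
Proof.
have [M [AM os ot _]] := common3 s t t; have [M' [AM' ou ov _]] := common3 u v v.
have [N [AN le le']] := common2 AM AM'; exists N; split=> //; apply/andP; split;
  by [apply: over_le le _|apply: over_le le' _].
Qed.

Lemma lim_addE s t : lim_add (lim s) (lim t) = lim (ladd s t).
Proof.
have [M [AM /andP[os ot] /andP[ors ort]]] :=
  common4 s t (repr (lim s)) (repr (lim t)).
apply: lim_eqP; exists M; rewrite /= os ot ors ort; split=> //.
by congr (_ + _); apply: (limeqE AM); rewrite ?repr_lim.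
Qed.

Lemma lim_mulE s t : lim_mul (lim s) (lim t) = lim (lmul s t).
Proof.
have [M [AM /andP[os ot] /andP[ors ort]]] :=
  common4 s t (repr (lim s)) (repr (lim t)).
apply: lim_eqP; exists M; rewrite /= os ot ors ort; split=> //.
by congr (_ * _); apply: (limeqE AM); rewrite ?repr_lim.
Qed.

Lemma lim_oppE t : lim_opp (lim t) = lim (lopp t).
Proof.
have [M [AM ot ort _]] := common3 t (repr (lim t)) t.
apply: lim_eqP; exists M; rewrite /= ot ort; split=> //.
by congr (- _); apply: (limeqE AM); rewrite ?repr_lim.
Qed.

Lemma lim_invE t : lim_inv (lim t) = lim (linv t).
Proof.
have [M [AM ot ort _]] := common3 t (repr (lim t)) t.
apply: lim_eqP; exists M; rewrite /= ot ort; split=> //.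
by congr (_^-1); apply: (limeqE AM); rewrite ?repr_lim.
Qed.

Variables (M0 : model) (A0 : A M0).

Lemma const_subproof c : `[< exists2 M, A M & over M (TK E c : term K E) >].
Proof. by apply/asboolP; exists M0. Qed.
Definition lconst c : limterm := limterm_of (const_subproof c).
Definition lim_const c := lim (lconst c).

Lemma lim_addA : associative lim_add.
Proof.
elim/limW=> s; elim/limW=> t; elim/limW=> u; rewrite !lim_addE.
have [M [AM os ot ou]] := common3 s t u.
by apply: lim_eqP; exists M; rewrite /= os ot ou /mval /= addrA.
Qed.

Lemma lim_addC : commutative lim_add.
Proof.
elim/limW=> s; elim/limW=> t; rewrite !lim_addE.
have [M [AM os ot _]] := common3 s t t.
by apply: lim_eqP; exists M; rewrite /= os ot /mval /= addrC.
Qed.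

Lemma lim_add0 : left_id (lim_const 0) lim_add.
Proof.
elim/limW=> s; rewrite !lim_addE; have [M AM os] := limtermP s.
by apply: lim_eqP; exists M; rewrite /= os /mval /= rmorph0 add0r.
Qed.

Lemma lim_addN : left_inverse (lim_const 0) lim_opp lim_add.
Proof.
elim/limW=> s; rewrite lim_oppE !lim_addE; have [M AM os] := limtermP s.
by apply: lim_eqP; exists M; rewrite /= os /mval /= rmorph0 addNr.
Qed.

HB.instance Definition _ :=
  GRing.isZmodule.Build limfield lim_addA lim_addC lim_add0 lim_addN.

Lemma lim_mulA : associative lim_mul.
Proof.
elim/limW=> s; elim/limW=> t; elim/limW=> u; rewrite !lim_mulE.
have [M [AM os ot ou]] := common3 s t u.
by apply: lim_eqP; exists M; rewrite /= os ot ou /mval /= mulrA.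
Qed.

Lemma lim_mulC : commutative lim_mul.
Proof.
elim/limW=> s; elim/limW=> t; rewrite !lim_mulE.
have [M [AM os ot _]] := common3 s t t.
by apply: lim_eqP; exists M; rewrite /= os ot /mval /= mulrC.
Qed.

Lemma lim_mul1 : left_id (lim_const 1) lim_mul.
Proof.
elim/limW=> s; rewrite !lim_mulE; have [M AM os] := limtermP s.
by apply: lim_eqP; exists M; rewrite /= os /mval /= rmorph1 mul1r.
Qed.

Lemma lim_mulDl : left_distributive lim_mul +%R.
Proof.
elim/limW=> s; elim/limW=> t; elim/limW=> u.
rewrite [_ + _]lim_addE !lim_mulE [RHS]lim_addE.
have [M [AM os ot ou]] := common3 s t u.
by apply: lim_eqP; exists M; rewrite /= os ot ou /mval /= mulrDl.
Qed.

Lemma lim_1_neq0 : lim_const 1 != 0.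
Proof.
apply/eqP=> /lim_eq D; have /eqP := @limeqE M0 (lconst 1) (lconst 0) A0 erefl erefl D.
by rewrite /mval /= rmorph1 rmorph0 oner_eq0.
Qed.

HB.instance Definition _ := GRing.Zmodule_isComNzRing.Build limfield
  lim_mulA lim_mulC lim_mul1 lim_mulDl lim_1_neq0.

Lemma lim_mulVf x : x != 0 -> lim_inv x * x = 1.
Proof.
elim/limW: x => s s0; rewrite lim_invE [_ * _]lim_mulE.
have [M AM os] := limtermP s; apply: lim_eqP; exists M.
rewrite /= os /mval /= rmorph1; split=> //; apply: mulVf.
apply: contraNneq s0 => s0; apply/eqP; apply: lim_eqP; exists M.
by rewrite /= os /mval /= rmorph0.
Qed.

Lemma lim_inv0 : lim_inv 0 = 0.
Proof.
rewrite [LHS]lim_invE; apply: lim_eqP; exists M0.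
by rewrite /= /mval /= rmorph0 invr0.
Qed.

HB.instance Definition _ := GRing.ComNzRing_isField.Build limfield
  lim_mulVf lim_inv0.

Lemma lim_eq0 (M : model) t : A M -> over M (val t) ->
  (lim t == 0) = (mval M (val t) == 0).
Proof.
move=> AM ot; have m0 : mval M (TK E 0) = 0 by rewrite /mval /= rmorph0.
apply/eqP/eqP=> [/lim_eq D|D].
  by rewrite (@limeqE M t (lconst 0)).
by apply: lim_eqP; exists M; rewrite D m0.
Qed.

Definition limring : {pred limfield} := [pred x | `[< exists M t,
  [/\ A M, over M (val t), x = lim t &
      mval M (val t) \in vsring (mring M)] >] ].

Lemma mem_limring (M : model) t : A M -> over M (val t) ->
  (lim t \in limring) = (mval M (val t) \in vsring (mring M)).
Proof.
move=> AM ot; apply/asboolP/idP=> [[M' [t' [AM' ot' tt' t'O]]]|tO]; last first.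
  by exists M, t.
have [N [AN le le']] := common2 AM AM'.
have [_ /(_ _ ot)[_ /= <-]] := le.
move/lim_eq: tt' => /(limeqE AN (over_le le ot) (over_le le' ot')) ->.
by have [_ /(_ _ ot')[_ /= ->]] := le'.
Qed.

Lemma limring_closed : subring_closed limring.
Proof.
split.
- by rewrite [1](_ : _ = lim (lconst 1)) // (@mem_limring M0) // /mval /=
             rmorph1 rpred1.
- elim/limW=> s; elim/limW=> t; have [M [AM os ot _]] := common3 s t t.
  rewrite (_ : lim s - lim t = lim (ladd s (lopp t))); last first.
    by rewrite [- lim t]lim_oppE [LHS]lim_addE.
  rewrite !(@mem_limring M) //= ?os ?ot //.
  exact: rpredB.
- elim/limW=> s; elim/limW=> t; have [M [AM os ot _]] := common3 s t t.
  rewrite [lim s * lim t]lim_mulE !(@mem_limring M) //= ?os ?ot //.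
  exact: rpredM.
Qed.

Lemma limring_total x : (x \in limring) || (x^-1 \in limring).
Proof.
elim/limW: x => t; have [M AM ot] := limtermP t.
by rewrite [(lim t)^-1]lim_invE !(@mem_limring M) //; apply: vsP.
Qed.

Definition limval := ValSub limring_closed limring_total.

Lemma lim_const_zmod : zmod_morphism lim_const.
Proof.
move=> c d; rewrite [- lim_const d]lim_oppE [RHS]lim_addE.
by apply: lim_eqP; exists M0; rewrite /mval /= rmorphB.
Qed.

Lemma lim_const_monoid : monoid_morphism lim_const.
Proof.
split=> // c d; rewrite [RHS]lim_mulE.
by apply: lim_eqP; exists M0; rewrite /mval /= rmorphM.
Qed.

HB.instance Definition _ := GRing.isZmodMorphism.Build K limfield
  lim_const lim_const_zmod.
HB.instance Definition _ := GRing.isMonoidMorphism.Build K limfield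
  lim_const lim_const_monoid.

Definition limdom (b : E) : bool := `[< exists2 M, A M & mdom M b >].
(** The value 0 is for the elements of E that are constants of no model in A. *)
Definition lim_elt (b : E) : limfield :=
  if insub (TE K b : term K E) is Some t then lim t else 0.

Local Notation ev := (eval lim_const lim_elt).

Lemma lim_eval_val (t : limterm) : ev (val t) = lim t.
Proof.
case: t => t ht /=; elim: t ht => [x|b|s IHs t IHt|s IHs t IHt|t IHt|t IHt] h /=.
- by congr lim; apply: val_inj.
- rewrite /lim_elt (insubT (fun t => `[< exists2 M, A M & over M t >]) h).
  by congr lim; apply: val_inj.
- have [M AM /= /andP[os ot]] := asboolW h.
  have hs : `[< exists2 M, A M & over M s >] by apply/asboolP; exists M.
  have ht : `[< exists2 M, A M & over M t >] by apply/asboolP; exists M.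
  rewrite (IHs hs) (IHt ht) [LHS]lim_addE; congr lim; exact: val_inj.
- have [M AM /= /andP[os ot]] := asboolW h.
  have hs : `[< exists2 M, A M & over M s >] by apply/asboolP; exists M.
  have ht : `[< exists2 M, A M & over M t >] by apply/asboolP; exists M.
  rewrite (IHs hs) (IHt ht) [LHS]lim_mulE; congr lim; exact: val_inj.
- by rewrite (IHt h) [LHS]lim_oppE; congr lim; apply: val_inj.
- by rewrite (IHt h) [LHS]lim_invE; congr lim; apply: val_inj.
Qed.

Lemma lim_eval (M : model) t : A M -> over M t ->
  (ev t == 0) = (mval M t == 0) /\
  (ev t \in vsring limval) = (mval M t \in vsring (mring M)).
Proof.
move=> AM ot; have h : `[< exists2 M, A M & over M t >].
  by apply/asboolP; exists M.
rewrite (lim_eval_val (limterm_of h)) (@lim_eq0 M) //; split=> //.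
exact: mem_limring.
Qed.

Lemma lim_eval_unit (M : model) t : A M -> over M t ->
  (ev t \in vsunit limval) = (mval M t \in vsunit (mring M)).
Proof.
move=> AM ot; rewrite !mem_vsunit; have [-> ->] := lim_eval AM ot.
by have [_ /= ->] := @lim_eval M (TInv t) AM ot.
Qed.

Lemma lim_eval_max (M : model) t : A M -> over M t ->
  (ev t \in vsmax limval) = (mval M t \in vsmax (mring M)).
Proof.
move=> AM ot; rewrite !mem_vsmax; have [-> _] := lim_eval AM ot.
by have [_ /= ->] := @lim_eval M (TInv t) AM ot.
Qed.

Lemma over_limdom (t : term K E) : term_over limdom t ->
  exists2 M, A M & over M t.
Proof.
elim: t => //= [x _|b /asboolP //|s IHs t IHt|s IHs t IHt]; first by exists M0.
  move=> /andP[/IHs[M AM os] /IHt[M' AM' ot]].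
  have [N [AN le le']] := common2 AM AM'; exists N => //.
  by rewrite (over_le le os) (over_le le' ot).
move=> /andP[/IHs[M AM os] /IHt[M' AM' ot]].
have [N [AN le le']] := common2 AM AM'; exists N => //.
by rewrite (over_le le os) (over_le le' ot).
Qed.

Lemma lim_eltE (M : model) (b : E) (s : term K E) :
  A M -> mdom M b -> over M s -> mE M b = mval M s -> lim_elt b = ev s.
Proof.
move=> AM ob os bs.
have h : `[< exists2 M, A M & over M (TE K b : term K E) >].
  by apply/asboolP; exists M.
have h' : `[< exists2 M, A M & over M s >] by apply/asboolP; exists M.
rewrite [LHS](lim_eval_val (limterm_of h)) (lim_eval_val (limterm_of h')).
by apply: lim_eqP; exists M.
Qed.

Lemma limdom2 x y : limdom x -> limdom y ->
  exists M, [/\ A M, mdom M x & mdom M y].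
Proof.
move=> /asboolP[M AM xM] /asboolP[M' AM' yM'].
have [N [AN [le _] [le' _]]] := common2 AM AM'.
by exists N; split=> //; [apply: le|apply: le'].
Qed.

Lemma limdom_closed : divring_closed (limdom : {pred E}).
Proof.
split=> [|x y xd yd|x y xd yd]; apply/asboolP.
- by exists M0 => //; case: (mdom_closed M0).
- have [M [AM xM yM]] := limdom2 xd yd; exists M => //.
  by case: (mdom_closed M) => _ + _; apply.
- have [M [AM xM yM]] := limdom2 xd yd; exists M => //.
  by case: (mdom_closed M) => _ _; apply.
Qed.

Lemma lim_elt1 : lim_elt 1 = 1.
Proof.
have d1 : mdom M0 1 by case: (mdom_closed M0).
rewrite (@lim_eltE M0 1 (TK E 1)) //=.
by rewrite mE1 /mval /= rmorph1.
Qed.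

Lemma lim_eltB x y : limdom x -> limdom y ->
  lim_elt (x - y) = lim_elt x - lim_elt y.
Proof.
move=> xd yd; have [M [AM xM yM]] := limdom2 xd yd.
rewrite (@lim_eltE M (x - y) (TAdd (TE K x) (TOpp (TE K y)))) //=.
- by case: (mdom_closed M) => _ + _; apply.
- by rewrite xM yM.
- by rewrite mEB.
Qed.

Lemma lim_eltM x y : limdom x -> limdom y ->
  lim_elt (x * y) = lim_elt x * lim_elt y.
Proof.
move=> xd yd; have [M [AM xM yM]] := limdom2 xd yd.
rewrite (@lim_eltE M (x * y) (TMul (TE K x) (TE K y))) //=.
- rewrite -[y]invrK; case: (mdom_closed M) => d1 _ dV; apply: (dV) => //.
  by rewrite -[y^-1]mul1r; apply: dV.
- by rewrite xM yM.
- by rewrite mEM.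
Qed.

Lemma limdomk a : limdom (kE a).
Proof. by apply/asboolP; exists M0 => //; apply: mdomk. Qed.

Lemma lim_eltk a : lim_elt (kE a) = lim_const (kK a).
Proof.
rewrite (@lim_eltE M0 (kE a) (TK E (kK a))) //; first exact: mdomk.
exact: mEk.
Qed.

Lemma limvalK x : (lim_const x \in vsring limval) = (x \in vsring OK).
Proof.
by have [_ /= ->] := @lim_eval M0 (TK E x) A0 erefl; apply: mringK.
Qed.

Lemma limvalE b : limdom b -> lim_elt b \in vsring limval.
Proof.
move=> /asboolP[M AM bM].
by have [_ /= ->] := @lim_eval M (TE K b) AM bM; apply: mringE.
Qed.

Lemma lim_value t : term_over limdom t -> ev t != 0 ->
  value_over p limval lim_const (ev t).
Proof.
move=> /over_limdom[M AM ot]; have [-> _] := lim_eval AM ot.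
move=> /(mvalue ot)[n [c tc]]; exists n, c.
have := @lim_eval_unit M (TMul (texp t (p ^ n)) (TInv (TK E c))) AM.
rewrite /= term_over_texp // /mval /= !eval_texp tc => /(_ erefl).
by [].
Qed.

Lemma lim_residue t : term_over limdom t -> ev t \in vsring limval ->
  residue_over OK p limval lim_const limdom lim_elt (ev t).
Proof.
move=> /over_limdom[M AM ot]; have [_ ->] := lim_eval AM ot.
move=> /(mresidue ot)[n [b [s [ibs /andP[ob os] sU tm]]]].
have sub u : over M u -> term_over limdom u.
  by apply: term_over_sub => x xM; apply/asboolP; exists M.
exists n, b, s; split=> //; first by rewrite !sub.
  by rewrite (lim_eval_unit AM).
have := @lim_eval_max M (TAdd (TMul s (texp t (p ^ n))) (TOpp b)) AM.
by rewrite /= os ob term_over_texp // /mval /= !eval_texp tm => /(_ erefl).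
Qed.

Definition limmodel : model := Model limdom_closed lim_elt1 lim_eltB lim_eltM
  limdomk lim_eltk limvalK limvalE lim_value lim_residue.

Lemma limmodel_ge M : A M -> model_le M limmodel.
Proof.
move=> AM; split=> [b bM|t ot]; first by apply/asboolP; exists M.
exact: lim_eval.
Qed.

Lemma limmodel_generated (x : mfield limmodel) :
  exists2 t, term_over (mdom limmodel) t & x = mval limmodel t.
Proof.
elim/limW: x => t; exists (val t).
  have [M AM ot] := limtermP t; apply: term_over_sub ot => b bM.
  by apply/asboolP; exists M.
by rewrite -lim_eval_val.
Qed.

End Limit.

(** * Adjoining one constant to a model *)

(** The closure proof is an argument so that the field structure can be
    inferred. *)
Definition subfield_type (N : fieldType) (D : {pred N})
  (D_closed : divring_closed D) := {x : N | x \in D}.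

Definition mk_divring (R : unitRingType) (B : {pred R}) of divring_closed B :=
  B.
HB.instance Definition _ (R : unitRingType) (B : {pred R})
    (sB : divring_closed B) :=
  GRing.isDivringClosed.Build R (mk_divring sB) sB.

Section SubfieldType.
Variables (N : fieldType) (D : {pred N}) (D_closed : divring_closed D).

HB.instance Definition _ := [isSub of subfield_type D_closed for sval].
HB.instance Definition _ := [Choice of subfield_type D_closed by <:].
HB.instance Definition _ := GRing.SubChoice_isSubIntegralDomain.Build N
  (mk_divring D_closed) (subfield_type D_closed) D_closed.
HB.instance Definition _ :=
  [SubIntegralDomain_isSubField of subfield_type D_closed by <:].

Definition subfield_of (x : N) (xD : x \in D) : subfield_type D_closed :=
  exist _ x xD.
Definition subfield_val : {rmorphism subfield_type D_closed -> N} := \val.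
End SubfieldType.

Section Preimage.
Variables (L N : fieldType) (e : {rmorphism L -> N}) (O : valsub N).

Definition valsub_pre_pred : {pred L} := [pred x | e x \in vsring O].
Lemma valsub_pre_closed : subring_closed valsub_pre_pred.
Proof.
split=> [|x y|x y]; rewrite !inE ?rmorph1 ?rpred1 // ?rmorphB ?rmorphM /=.
  exact: rpredB.
exact: rpredM.
Qed.
Lemma valsub_pre_total x :
  (x \in valsub_pre_pred) || (x^-1 \in valsub_pre_pred).
Proof. by rewrite !inE fmorphV; apply: vsP. Qed.
Definition valsub_pre := ValSub valsub_pre_closed valsub_pre_total.
Lemma mem_valsub_pre x : (e x \in vsring O) = (x \in vsring valsub_pre).
Proof. by []. Qed.
End Preimage.

Section Adjoin.
Variables (L N : fieldType) (e : {rmorphism L -> N}) (y : N).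
Local Notation ev g := (map_poly e g).[y].

(** The subfield generated by L and y. *)
Definition adjoin : {pred N} :=
  [pred x | `[< exists g h : {poly L}, ev h != 0 /\ x = ev g / ev h >] ].

Lemma adjoinP x :
  reflect (exists g h : {poly L}, ev h != 0 /\ x = ev g / ev h) (x \in adjoin).
Proof. exact: asboolP. Qed.

Lemma adjoin_poly g : ev g \in adjoin.
Proof.
by apply/adjoinP; exists g, 1; rewrite rmorph1 hornerC oner_eq0 divr1.
Qed.

Lemma adjoin_const c : e c \in adjoin.
Proof. by have := adjoin_poly c%:P; rewrite map_polyC hornerC. Qed.

Lemma adjoin_gen : y \in adjoin.
Proof. by have := adjoin_poly 'X; rewrite map_polyX hornerX. Qed.

Lemma adjoin_closed : divring_closed adjoin.
Proof.
split=> [|_ _ /adjoinP[g [h [h0 ->]]] /adjoinP[g1 [h1 [h10 ->]]]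
         |_ _ /adjoinP[g [h [h0 ->]]] /adjoinP[g1 [h1 [h10 ->]]]].
- by rewrite -(rmorph1 e); apply: adjoin_const.
- apply/adjoinP; exists (g * h1 - g1 * h), (h * h1).
  rewrite !(rmorphB, rmorphM) /= !(hornerD, hornerN, hornerM) mulf_neq0 //.
  by split=> //; field; rewrite h0 h10.
- have [g10|g10] := eqVneq (ev g1) 0.
    apply/adjoinP; exists 0, 1; rewrite rmorph1 rmorph0 !hornerC oner_eq0.
    by rewrite g10 mul0r invr0 mulr0 mul0r.
  apply/adjoinP; exists (g * h1), (h * g1).
  rewrite !rmorphM /= !hornerM mulf_neq0 //.
  by split=> //; field; rewrite g10 h0 h10.
Qed.

End Adjoin.

(** Extension of a partial homomorphism from F to F(a), when the image y of a
    satisfies the same relations as a. *)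
Section HomExtension.
Variables (F E N : fieldType) (s : {rmorphism F -> E}) (r : {rmorphism F -> N}).
Variables (a : E) (y : N).
Local Notation evE g := (map_poly s g).[a].
Local Notation evN g := (map_poly r g).[y].

Definition hom_ext (b : E) : N := xget 0 (fun z => exists g h : {poly F},
  [/\ evE h != 0, b = evE g / evE h & z = evN g / evN h]).

Hypothesis neq0_y : forall g : {poly F}, evE g != 0 -> evN g != 0.
Hypothesis zero_y : forall g : {poly F}, evE g = 0 -> evN g = 0.

Lemma hom_extE g h : evE h != 0 -> hom_ext (evE g / evE h) = evN g / evN h.
Proof.
move=> h0; rewrite /hom_ext; case: xgetP => [z _ [g1 [h1 [h10 gh ->]]]|no].
  have hN0 := neq0_y h0; have hN10 := neq0_y h10.
  have : evE (g1 * h - g * h1) = 0.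
    rewrite rmorphB !rmorphM /= hornerD hornerN !hornerM.
    by apply/eqP; rewrite subr_eq0 -eqr_div // gh.
  move=> /zero_y; rewrite rmorphB !rmorphM /= hornerD hornerN !hornerM => /eqP.
  by rewrite subr_eq0 -eqr_div // => /eqP.
by case: (no (evN g / evN h)); exists g, h.
Qed.

Lemma hom_ext_poly g : hom_ext (evE g) = evN g.
Proof.
have := @hom_extE g 1; rewrite !rmorph1 !hornerC !divr1 => -> //.
exact: oner_neq0.
Qed.

Lemma hom_ext_const b : hom_ext (s b) = r b.
Proof. by have := hom_ext_poly b%:P; rewrite !map_polyC !hornerC. Qed.

Lemma hom_ext_gen : hom_ext a = y.
Proof. by have := hom_ext_poly 'X; rewrite !map_polyX !hornerX. Qed.

Lemma hom_extB b c : b \in adjoin s a -> c \in adjoin s a ->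
  hom_ext (b - c) = hom_ext b - hom_ext c.
Proof.
move=> /adjoinP[g [h [h0 ->]]] /adjoinP[g1 [h1 [h10 ->]]].
have hN0 := neq0_y h0; have hN10 := neq0_y h10.
rewrite !hom_extE //.
have -> : evE g / evE h - evE g1 / evE h1 =
          evE (g * h1 - g1 * h) / evE (h * h1).
  rewrite !(rmorphB, rmorphM) /= !(hornerD, hornerN, hornerM).
  by field; rewrite h0 h10.
rewrite hom_extE; last by rewrite rmorphM hornerM mulf_neq0.
rewrite !(rmorphB, rmorphM) /= !(hornerD, hornerN, hornerM).
by field; rewrite hN0 hN10.
Qed.

Lemma hom_extM b c : b \in adjoin s a -> c \in adjoin s a ->
  hom_ext (b * c) = hom_ext b * hom_ext c.
Proof.
move=> /adjoinP[g [h [h0 ->]]] /adjoinP[g1 [h1 [h10 ->]]].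
rewrite !hom_extE // mulf_div -!hornerM -!rmorphM hom_extE; last first.
  by rewrite rmorphM hornerM mulf_neq0.
by rewrite !rmorphM !hornerM mulf_div.
Qed.

End HomExtension.

Section ModelAdjoin.
Variables (K : fieldType) (OK : valsub K) (k E : fieldType).
Variables (kK : {rmorphism k -> K}) (kE : {rmorphism k -> E}) (p : nat).
Hypothesis hp : char_exponent k p.
Local Notation model := (model OK kK kE p).
Variable M : model.
Local Notation over t := (term_over (@mdom _ _ _ _ _ _ _ M) t).

Definition mconst := subfield_type (mdom_closed M).
HB.instance Definition _ := GRing.Field.on mconst.

Definition mconst_val : {rmorphism mconst -> E} :=
  subfield_val (mdom_closed M).

Definition mconst_eval (b : mconst) : mfield M := mE M (mconst_val b).

Lemma mconst_dom (b : mconst) : mdom M (mconst_val b).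
Proof. exact: (valP b). Qed.

Lemma mconst_eval_zmod : zmod_morphism mconst_eval.
Proof. by move=> b c; rewrite /mconst_eval rmorphB mEB ?mconst_dom. Qed.
Lemma mconst_eval_monoid : monoid_morphism mconst_eval.
Proof.
by split=> [|b c]; rewrite /mconst_eval ?rmorph1 ?mE1 // rmorphM mEM ?mconst_dom.
Qed.
HB.instance Definition _ :=
  GRing.isZmodMorphism.Build mconst (mfield M) mconst_eval mconst_eval_zmod.
HB.instance Definition _ :=
  GRing.isMonoidMorphism.Build mconst (mfield M) mconst_eval mconst_eval_monoid.

Lemma mconst_unit b : b != 0 -> mconst_eval b \in vsunit (mring M).
Proof.
move=> b0; rewrite mem_vsunit fmorph_eq0 b0 -fmorphV.
by rewrite !mringE // mconst_dom.
Qed.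

Variables (N : fieldType) (e : {rmorphism mfield M -> N}) (O : valsub N).
Hypothesis eO : forall x, (e x \in vsring O) = (x \in vsring (mring M)).
Variables (a : E) (y : N).

Definition mconst_hom : {rmorphism mconst -> N} := e \o mconst_eval.
Local Notation evE g := (map_poly mconst_val g).[a].
Local Notation evN g := (map_poly mconst_hom g).[y].

Hypothesis unit_y : forall g : {poly mconst}, evE g != 0 -> evN g \in vsunit O.
Hypothesis zero_y : forall g : {poly mconst}, evE g = 0 -> evN g = 0.

Variable D : {pred N}.
Hypothesis D_closed : divring_closed D.
Hypothesis D_M : forall t, over t -> e (mval M t) \in D.
Hypothesis D_y : y \in D.
Hypothesis D_value : forall Q, value_closed p O Q ->
  (forall t, over t -> mval M t != 0 -> Q (e (mval M t))) ->
  forall x, x \in D -> x != 0 -> Q x.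
Hypothesis D_residue : forall R, residue_closed p O R ->
  (forall t, over t -> mval M t \in vsring (mring M) -> R (e (mval M t))) ->
  R y -> forall x, x \in D -> x \in vsring O -> R x.

Definition adom : E -> bool := fun b => b \in adjoin mconst_val a.

Let neq0_y g (g0 : evE g != 0) : evN g != 0 := vsunit_neq0 (unit_y g0).

Definition aelt : E -> N := hom_ext mconst_val mconst_hom a y.

Lemma adom_const b : mdom M b -> adom b.
Proof.
move=> bM; exact: (adjoin_const mconst_val a (subfield_of (mdom_closed M) bM)).
Qed.

Lemma aelt_old b : mdom M b -> aelt b = e (mE M b).
Proof. move=> bM.
exact: (hom_ext_const neq0_y zero_y (subfield_of (mdom_closed M) bM)). Qed.

Lemma aelt1 : aelt 1 = 1.
Proof.
rewrite -(rmorph1 mconst_val) -(rmorph1 mconst_hom).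
exact: (hom_ext_const neq0_y zero_y).
Qed.

Lemma aeltB b c : adom b -> adom c -> aelt (b - c) = aelt b - aelt c.
Proof. exact: (hom_extB neq0_y zero_y). Qed.

Lemma aeltM b c : adom b -> adom c -> aelt (b * c) = aelt b * aelt c.
Proof. exact: (hom_extM neq0_y zero_y). Qed.

Lemma aelt_ring b : adom b -> aelt b \in vsring O.
Proof.
move=> /adjoinP[g [h [h0 ->]]]; rewrite /aelt (hom_extE neq0_y zero_y g h0) rpredM //; last first.
  by rewrite vsunitW ?vsunitV ?unit_y.
have [/zero_y->|/unit_y/vsunitW //] := eqVneq (evE g) 0.
exact: rpred0.
Qed.

Local Notation eK := (e \o mK M).
Local Notation ev t := (eval eK aelt t).

Lemma aeval_old t : over t -> ev t = e (mval M t).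
Proof.
rewrite /mval; elim: t => //= [b /aelt_old //|s IHs t IHt|s IHs t IHt|t IHt|t IHt].
- by move=> /andP[/IHs-> /IHt->]; rewrite rmorphD.
- by move=> /andP[/IHs-> /IHt->]; rewrite rmorphM.
- by move=> /IHt->; rewrite rmorphN.
- by move=> /IHt->; rewrite fmorphV.
Qed.

Lemma D_sub u v : u \in D -> v \in D -> u - v \in D.
Proof. by case: D_closed => _ + _; apply. Qed.
Lemma D_div u v : u \in D -> v \in D -> u / v \in D.
Proof. by case: D_closed => _ _; apply. Qed.

Lemma D_poly g : evN g \in D.
Proof.
pose D' := mk_divring D_closed; rewrite -[D]/D' horner_coef.
apply: rpred_sum => i _; rewrite rpredM ?rpredX // coef_map /=.
exact: (@D_M (TE K (mconst_val g`_i)) (mconst_dom _)).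
Qed.

Lemma aeval_D t : term_over adom t -> ev t \in D.
Proof.
have D1 : 1 \in D by case: D_closed.
have D0 : 0 \in D by rewrite -(subrr 1) D_sub.
have DN u : u \in D -> - u \in D by move=> uD; rewrite -sub0r D_sub.
have DV u : u \in D -> u^-1 \in D by move=> uD; rewrite -div1r D_div.
elim: t => //= [x _|b /adjoinP[g [h [h0 ->]]]|s IHs t IHt|s IHs t IHt|t IHt|t IHt].
- exact: (@D_M (TK E x)).
- by rewrite /aelt (hom_extE neq0_y zero_y g h0) D_div ?D_poly.
- move=> /andP[/IHs sD /IHt tD]; rewrite -[X in _ + X]opprK D_sub //.
  exact: DN.
- move=> /andP[/IHs sD /IHt tD]; rewrite -[X in _ * X]invrK D_div //.
  exact: DV.
- by move/IHt/DN.
- by move/IHt/DV.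
Qed.

Lemma aringK x : (eK x \in vsring O) = (x \in vsring OK).
Proof. by rewrite /= eO mringK. Qed.

Lemma avalue t : term_over adom t -> ev t != 0 -> value_over p O eK (ev t).
Proof.
move=> /aeval_D; apply: D_value; first exact: value_over_closed.
move=> {}t ot /(mvalue ot)[n [c tc]]; exists n, c.
by rewrite /= -rmorphXn -fmorph_div (vsunit_map eO).
Qed.

Lemma aresidue t : term_over adom t -> ev t \in vsring O ->
  residue_over OK p O eK adom aelt (ev t).
Proof.
move=> /aeval_D; apply: D_residue.
- apply: (residue_over_closed kK hp); first exact: aringK.
  exact: aelt_ring.
- move=> {}t ot /(mresidue ot)[n [b [s [ibs /andP[ob os] sU tm]]]].
  exists n, b, s; rewrite !aeval_old // (vsunit_map eO); split=> //.
    by rewrite !(term_over_sub adom_const).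
  by rewrite -rmorphXn -rmorphM -rmorphB (vsmax_map eO).
- have /= := @residue_over_int K OK E p N O eK adom aelt (TE K a) erefl.
  have -> : aelt a = y := hom_ext_gen neq0_y zero_y.
  by apply; apply: adjoin_gen.
Qed.

Lemma adom_closed : divring_closed (adom : {pred E}).
Proof. exact: adjoin_closed. Qed.

Lemma adomk c : adom (kE c).
Proof. exact/adom_const/mdomk. Qed.

Lemma aeltk c : aelt (kE c) = eK (kK c).
Proof. by rewrite aelt_old ?mdomk // mEk. Qed.

Definition amodel : model := Model adom_closed aelt1 aeltB aeltM adomk aeltk
  aringK aelt_ring avalue aresidue.

(** A model extends to a once values for the polynomial expressions in a are
    given, the subfield D controlling values and residues of the result. *)
Lemma model_adjoin : exists2 M' : model, model_le M M' & mdom M' a.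
Proof.
exists amodel; last exact: adjoin_gen.
split=> [b|t ot]; first exact: adom_const.
by rewrite /= /mval /= aeval_old // fmorph_eq0 eO.
Qed.

End ModelAdjoin.

(** * Transcendental and radical constants *)

Lemma primitive_map (L N : fieldType) (e : {rmorphism L -> N}) (O : valsub N)
    (OL : valsub L) : (forall x, (e x \in vsring O) = (x \in vsring OL)) ->
  forall g, primitive OL g -> primitive O (map_poly e g).
Proof.
move=> eO g gp; have [i gi _] := primitiveP gp.
apply: (@primitive_coef _ _ _ i); last by rewrite coef_map (vsunit_map eO).
apply/polyOverP=> j; rewrite coef_map /= eO.
exact: (polyOverP (primitiveW gp)).
Qed.

Lemma poly_cong (N : fieldType) (O : valsub N) (g : {poly N}) x y :
    g \is a polyOver (vsring O) -> x \in vsring O -> y \in vsring O ->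
  x - y \in vsmax O -> g.[x] - g.[y] \in vsmax O.
Proof.
move=> /polyOverP gO xO yO xy; rewrite !horner_coef -sumrB rpred_sum // => i _.
rewrite -mulrBr subrXX vsmaxM // vsmaxMl // rpred_sum // => j _.
by rewrite rpredM ?rpredX.
Qed.

Section AdjoinControl.
Variables (L N : fieldType) (e : {rmorphism L -> N}) (y : N).
Variables (O : valsub N) (OL : valsub L) (p : nat).
Hypothesis eO : forall x, (e x \in vsring O) = (x \in vsring OL).
Local Notation ev g := (map_poly e g).[y].

(* as for the Gauss valuation, polynomials in y have values in L *)
Hypothesis gauss_like : forall g, ev g != 0 -> exists c h,
  [/\ c != 0, h \is a polyOver (vsring OL), ev h \in vsunit O
    & ev g = e c * ev h].

Lemma adjoin_quotient x : x \in adjoin e y -> x != 0 -> exists c g h,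
  [/\ c != 0, g \is a polyOver (vsring OL) /\ h \is a polyOver (vsring OL),
      ev g \in vsunit O, ev h \in vsunit O & x = e c * (ev g / ev h)].
Proof.
move=> /adjoinP[g [h [h0 ->]]] gh0.
have g0 : ev g != 0 by apply: contraNneq gh0 => ->; rewrite mul0r.
have [c [g1 [c0 g1O g1U ->]]] := gauss_like g0.
have [d [h1 [d0 h1O h1U ->]]] := gauss_like h0.
exists (c / d), g1, h1; split=> //; first by rewrite mulf_neq0 ?invr_eq0.
by rewrite fmorph_div mulf_div.
Qed.

Lemma adjoin_value (Q : N -> Prop) : value_closed p O Q ->
  (forall c, c != 0 -> Q (e c)) ->
  forall x, x \in adjoin e y -> x != 0 -> Q x.
Proof.
move=> [QU QM QV _] Qe x xD /(adjoin_quotient xD)[c [g [h [c0 _ gU hU ->]]]].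
by apply: QM; [exact: Qe|apply: QU; rewrite vsunitM ?vsunitV].
Qed.

Lemma adjoin_residue (R : N -> Prop) : residue_closed p O R ->
  (forall c, c \in vsring OL -> R (e c)) -> R y ->
  forall x, x \in adjoin e y -> x \in vsring O -> R x.
Proof.
move=> [R1 Rm [RD RN] [RM RV] _] Re Ry x xD xO.
have RX n : R (y ^+ n).
  by elim: n => [|n IHn]; rewrite ?expr0 ?exprS //; apply: RM.
have Rpoly (g : {poly L}) : g \is a polyOver (vsring OL) -> R (ev g).
  move=> /polyOverP gO; rewrite horner_coef.
  elim/big_ind: _ => // [|i _]; first by apply: Rm; apply: vsmax0.
  by rewrite coef_map; apply: RM => //; apply: Re.
have [->|x0] := eqVneq x 0; first by apply: Rm; apply: vsmax0.
have [c [g [h [c0 [gO hO] gU hU Dx]]]] := adjoin_quotient xD x0.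
rewrite Dx; apply: (RM); last by apply: (RM); [exact: Rpoly|apply: RV; auto].
apply: Re; rewrite -eO.
have -> : e c = x * (ev h / ev g).
  by rewrite Dx -mulrA mulf_div [ev h * _]mulrC divff ?mulr1 // mulf_neq0 //;
     apply: vsunit_neq0; eassumption.
by rewrite rpredM // vsunitW // vsunitM // vsunitV.
Qed.

End AdjoinControl.

(** What is needed to extend a model with field N, values and residues in L and
    constants F, to the constant a: values for the polynomial expressions in a,
    and a subfield D where values and residues are controlled by L. *)
Definition extension_datum (p : nat) (F E L N : fieldType)
    (s : {rmorphism F -> E}) (r : {rmorphism F -> L}) (i : {rmorphism L -> N})
    (O : valsub N) (a : E) : Prop :=
  exists (N' : fieldType) (e : {rmorphism N -> N'}) (O' : valsub N') (y : N')
    (D : {pred N'}),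
  [/\ forall x, (e x \in vsring O') = (x \in vsring O),
      forall g : {poly F},
        ((map_poly s g).[a] != 0 ->
           (map_poly (e \o (i \o r)) g).[y] \in vsunit O') /\
        ((map_poly s g).[a] = 0 -> (map_poly (e \o (i \o r)) g).[y] = 0),
      divring_closed D /\ (forall x, e (i x) \in D) /\ y \in D,
      forall Q, value_closed p O' Q -> (forall c, c != 0 -> Q (e (i c))) ->
        forall x, x \in D -> x != 0 -> Q x
    & forall R, residue_closed p O' R ->
        (forall c, i c \in vsring O -> R (e (i c))) -> R y ->
        forall x, x \in D -> x \in vsring O' -> R x].

Section Extensions.
Variables (p : nat) (F E L N : fieldType).
Variables (s : {rmorphism F -> E}) (r : {rmorphism F -> L}).
Variables (i : {rmorphism L -> N}) (O : valsub N) (a : E).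
Hypothesis rU : forall b, b != 0 -> i (r b) \in vsunit O.

Let OL := valsub_pre i O.
Let iO : forall x, (i x \in vsring O) = (x \in vsring OL).
Proof. by []. Qed.

Let rO b : i (r b) \in vsring O.
Proof.
by have [->|/rU/vsunitW //] := eqVneq b 0; rewrite !rmorph0 rpred0.
Qed.

(** The generic element t of the Gauss extension is the image of a. *)
Lemma transcendental_datum :
  (forall g, g != 0 -> (map_poly s g).[a] != 0) ->
  extension_datum p s r i O a.
Proof.
move=> tr; have [N' [e [O' [t [eO tU]]]]] := gauss_extension O.
pose ei : {rmorphism L -> N'} := e \o i.
have eiO x : (ei x \in vsring O') = (x \in vsring OL) by rewrite /= eO.
have gl (g : {poly L}) : (map_poly ei g).[t] != 0 -> exists c h,
    [/\ c != 0, h \is a polyOver (vsring OL),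
        (map_poly ei h).[t] \in vsunit O' &
        (map_poly ei g).[t] = ei c * (map_poly ei h).[t]].
  have [->|g0 _] := eqVneq g 0; first by rewrite rmorph0 horner0 eqxx.
  have [n gn gp] := primitive_content OL g0; exists g`_n, ((g`_n)^-1 *: g).
  split=> //; first exact: primitiveW.
    by rewrite map_poly_comp; apply/tU/(primitive_map iO).
  by rewrite map_polyZ hornerZ mulrA -rmorphM divff // rmorph1 mul1r.
exists N', e, O', t, (adjoin ei t); split=> //.
- move=> g; split=> [g0|]; last first.
    by have [->|/tr/negPf tg /eqP] := eqVneq g 0; [rewrite !rmorph0 !horner0|
       rewrite tg].
  have {}g0 : g != 0 by apply: contraNneq g0 => ->; rewrite rmorph0 horner0.
  rewrite map_poly_comp; apply/tU/(@primitive_coef _ _ _ (size g).-1).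
    by apply/polyOverP=> n; rewrite coef_map /=; apply: rO.
  by rewrite coef_map /= rU // -lead_coefE lead_coef_eq0.
- by split; [exact: adjoin_closed|split=> [x|]; [exact: (adjoin_const ei)|exact: adjoin_gen]].
- by move=> Q Qc Qe; apply: (adjoin_value gl Qc).
- by move=> R Rc Re Rt; apply: (adjoin_residue eiO gl Rc).
Qed.

(** Frobenius maps polynomial expressions in a, and in the root y, to
    constants; the controlled subfield D consists of the elements with p-th
    power in L. *)
Lemma radical_datum c : p \in [pchar F] -> a ^+ p = s c ->
  extension_datum p s r i O a.
Proof.
move=> pF ap.
have p0 : (0 < p)%N by rewrite prime_gt0 // (pcharf_prime pF).
have mono : 'X^p - (i (r c))%:P \is monic.
  by rewrite monicE lead_coefDl ?lead_coefXn ?size_polyN ?size_polyXn //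
     (leq_ltn_trans (size_polyC_leq1 _)).
have [N' [e [O' [rs [eO Drs]]]]] := valued_splitting O mono.
have [y yp] : exists y, y ^+ p = e (i (r c)).
  case: rs Drs => [|y rs] Drs.
    move/(congr1 (fun q : {poly N'} => size q)): Drs.
    rewrite big_nil size_poly1 size_map_poly size_polyDl ?size_polyXn //.
      by case: p p0.
    by rewrite size_polyN (leq_ltn_trans (size_polyC_leq1 _)).
  exists y; have := congr1 (fun q : {poly N'} => q.[y]) Drs.
  rewrite big_cons hornerM hornerXsubC subrr mul0r rmorphB /= map_polyXn.
  by rewrite map_polyC hornerD hornerN hornerXn hornerC => /eqP; rewrite subr_eq0 => /eqP.
have pE : p \in [pchar E] by rewrite (fmorph_pchar s).
have pN' : p \in [pchar N'] by rewrite (fmorph_pchar (e \o (i \o r))).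
pose frob := pFrobenius_aut pF.
have frobE (G : fieldType) (pG : p \in [pchar G]) (w : {rmorphism F -> G}) g z :
    z ^+ p = w c -> (map_poly w g).[z] ^+ p = w (map_poly frob g).[c].
  move=> zp; rewrite -(pFrobenius_autE pG) -horner_map /= pFrobenius_autE zp.
  rewrite -horner_map /= -!map_poly_comp; congr (_.[_]).
  by apply: eq_map_poly => b /=; rewrite !pFrobenius_autE rmorphXn.
have yE (g : {poly F}) : (map_poly (e \o (i \o r)) g).[y] ^+ p =
    e (i (r (map_poly frob g).[c])).
  exact: (frobE _ pN' (e \o (i \o r))).
pose D : {pred N'} := [pred x | `[< exists z, x ^+ p = e (i z) >] ].
have DP x : reflect (exists z, x ^+ p = e (i z)) (x \in D) by exact: asboolP.
exists N', e, O', y, D; split=> //.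
- move=> g; have := frobE _ pE s g a ap; have := yE g.
  set z := _.[c] => yz az; split=> g0.
    apply: (vsunit_root p0); rewrite yz (vsunit_map eO) rU //.
    apply: contraNneq g0 => z0; move/eqP: az.
    by rewrite z0 rmorph0 expf_eq0 p0.
  have z0 : z = 0.
    by apply/eqP; rewrite -(fmorph_eq0 s) -az g0 expr0n eqn0Ngt p0.
  by apply/eqP; move/eqP: yz; rewrite z0 !rmorph0 expf_eq0 p0.
- split; last split=> [x|].
  + split=> [|u v /DP[u' Du] /DP[v' Dv]|u v /DP[u' Du] /DP[v' Dv]]; apply/DP.
    * by exists 1; rewrite expr1n !rmorph1.
    * exists (u' - v'); rewrite -(pFrobenius_autE pN') rmorphB /=.
      by rewrite !pFrobenius_autE Du Dv !rmorphB.
    * by exists (u' / v'); rewrite expr_div_n Du Dv !fmorph_div.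
  + by apply/DP; exists (x ^+ p); rewrite !rmorphXn.
  + by apply/DP; exists (r c).
- move=> Q [_ _ _ Qp] Qe x /DP[z xz] x0; apply: Qp => //.
  rewrite xz; apply: Qe; apply: contraNneq x0 => z0.
  by move/eqP: xz; rewrite z0 !rmorph0 expf_eq0 p0.
- move=> R [_ _ _ _ Rp] Re _ x /DP[z xz] xO; apply: Rp => //.
  by rewrite xz; apply: Re; rewrite -eO -xz rpredX.
Qed.

End Extensions.

(** * Separable constants: the residue field extension *)

(** The derivative of f takes at a root the product of the differences with the
    other roots, and the Bezout relation makes this value a unit. *)
Lemma separable_roots (N : fieldType) (O : valsub N) (f u w : {poly N})
    (rs : seq N) :
    w \is a polyOver (vsring O) ->
    u * f + w * f^`() = 1 -> f = \prod_(r <- rs) ('X - r%:P) ->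
    (forall r, r \in rs -> r \in vsring O) ->
  uniq rs /\ forall r1 r2, r1 \in rs -> r2 \in rs -> r1 != r2 ->
    r1 - r2 \in vsunit O.
Proof.
move=> wO bez Df rsO.
have f'U r : r \in rs -> w.[r] * f^`().[r] = 1.
  move=> rrs; have := congr1 (fun q : {poly N} => q.[r]) bez.
  rewrite hornerD !hornerM hornerC => <-.
  suff -> : f.[r] = 0 by rewrite mulr0 add0r.
  by apply/eqP; rewrite Df -/(root _ _) root_prod_XsubC.
have split_at r1 rs1 : perm_eq rs (r1 :: rs1) ->
    \prod_(r <- rs1) (r1 - r) \in vsunit O.
  move=> prs; have r1rs : r1 \in rs by rewrite (perm_mem prs) mem_head.
  have := f'U _ r1rs; rewrite Df (perm_big _ prs) big_cons derivM.
  rewrite hornerD !hornerM hornerXsubC subrr mul0r addr0.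
  rewrite derivXsubC hornerC mul1r horner_prod.
  under eq_bigr do rewrite hornerXsubC.
  set P := \prod_(r <- rs1) _ => wP.
  have P0 : P != 0.
    by apply: contra_eq_neq wP => ->; rewrite mulr0 eq_sym oner_eq0.
  have PO : P \in vsring O.
    rewrite /P big_seq rpred_prod // => r rrs.
    by rewrite rpredB ?rsO // (perm_mem prs) inE rrs orbT.
  rewrite mem_vsunit P0 PO /=.
  have -> : P^-1 = w.[r1] by apply: (mulIf P0); rewrite mulVf.
  by rewrite rpred_horner ?rsO.
have far r1 rs1 r2 : perm_eq rs (r1 :: rs1) -> r2 \in rs1 ->
    r1 - r2 \in vsunit O.
  move=> prs r2rs; have := split_at _ _ prs.
  rewrite (perm_big _ (perm_to_rem r2rs)) big_cons !vsunitE => /andP[_].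
  have sub r : r \in rs1 -> r1 - r \in vsring O.
    by move=> rrs; rewrite rpredB ?rsO // (perm_mem prs) inE ?eqxx // rrs orbT.
  rewrite vsmax_prime ?sub //; last first.
    by rewrite big_seq rpred_prod // => r /mem_rem; apply: sub.
  by rewrite negb_or => /andP[].
split=> [|r1 r2 r1s r2s r12]; last first.
  apply: (far _ (rem r1 rs)); first exact: perm_to_rem.
  have := perm_mem (perm_to_rem r1s) r2; rewrite r2s inE eq_sym (negbTE r12).
  by move=> /esym.
apply: contraT => /uniqPn - /(_ 0)[m [n [mn n_rs e_mn]]].
have m_rs : (m < size rs)%N by apply: ltn_trans mn n_rs.
pose rs1 := take m rs ++ drop m.+1 rs.
have prs : perm_eq rs (nth 0 rs m :: rs1).
  rewrite -{1}(cat_take_drop m rs) (drop_nth 0 m_rs) /rs1.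
  by rewrite perm_catC /= perm_cons perm_catC.
have := far _ _ (nth 0 rs n) prs; rewrite e_mn subrr mem_vsunit eqxx /=.
apply; rewrite mem_cat; apply/orP; right.
rewrite -(subnKC mn) -nth_drop mem_nth // size_drop ltn_sub2r //.
exact: leq_ltn_trans mn n_rs.
Qed.

Section SubfieldLift.
Variables (L N : fieldType) (e : {rmorphism L -> N}) (D : {pred N}).
Variables (D_closed : divring_closed D) (eD : forall x, e x \in D).

Definition subfield_lift (x : L) : subfield_type D_closed :=
  subfield_of D_closed (eD x).
Lemma subfield_lift_zmod : zmod_morphism subfield_lift.
Proof. by move=> x y; apply: val_inj; rewrite /= rmorphB. Qed.
Lemma subfield_lift_monoid : monoid_morphism subfield_lift.
Proof. by split=> [|x y]; apply: val_inj; rewrite /= ?rmorph1 ?rmorphM. Qed.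
HB.instance Definition _ := GRing.isZmodMorphism.Build L
  (subfield_type D_closed) subfield_lift subfield_lift_zmod.
HB.instance Definition _ := GRing.isMonoidMorphism.Build L
  (subfield_type D_closed) subfield_lift subfield_lift_monoid.
End SubfieldLift.

Lemma irreducible_coprime (F : fieldType) (f g : {poly F}) :
  irreducible_poly f -> ~~ (f %| g) -> coprimep f g.
Proof.
move=> [_ irr] fg; rewrite /coprimep; apply: contraT => sg.
have := irr _ sg (dvdp_gcdl f g); rewrite /eqp => /andP[_ ff].
by rewrite (dvdp_trans ff (dvdp_gcdr f g)) in fg.
Qed.

(** Let H be a monic integral polynomial of least degree for which H(y) is not
    a unit: it lifts the minimal polynomial of the residue of y. One of its
    roots z is congruent to y, and g(z) is a unit when g is primitive of degree
    less than deg H, by minimality of H. A general g is first reduced modulo H. *)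
Lemma residue_generator (L N : fieldType) (i : {rmorphism L -> N})
    (O : valsub N) (y : N) (h : {poly L}) :
    let OL := valsub_pre i O in
    h \is monic -> h \is a polyOver (vsring OL) -> y \in vsring O ->
    (map_poly i h).[y] \in vsmax O ->
  exists (N' : fieldType) (e : {rmorphism N -> N'}) (O' : valsub N') (z : N'),
  [/\ forall x, (e x \in vsring O') = (x \in vsring O),
      e y - z \in vsmax O'
    & forall g : {poly L}, (map_poly (e \o i) g).[z] != 0 -> exists c g',
      [/\ c != 0, g' \is a polyOver (vsring OL),
          (map_poly (e \o i) g').[z] \in vsunit O' &
          (map_poly (e \o i) g).[z] = (e \o i) c * (map_poly (e \o i) g').[z]]].
Proof.
move=> OL hm hO yO hy.
pose P (H : {poly L}) := [/\ H \is monic, H \is a polyOver (vsring OL)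
  & (map_poly i H).[y] \in vsmax O].
have ex : exists n, `[< exists2 H, P H & size H = n >].
  by exists (size h); apply/asboolP; exists h.
case: (ex_minnP ex) => n /asboolP[H [Hm HO Hy] sH] min_n.
have {}min_n (G : {poly L}) : P G -> (size H <= size G)%N.
  by move=> PG; rewrite sH; apply: min_n; apply/asboolP; exists G.
have H0 : H != 0 := monic_neq0 Hm.
have HNm : map_poly i H \is monic by rewrite map_monic.
have [N' [e [O' [zs [eO Dzs]]]]] := valued_splitting O HNm.
have polyO (G : {poly L}) : G \is a polyOver (vsring OL) ->
    map_poly i G \is a polyOver (vsring O).
  by move=> /polyOverP GO; apply/polyOverP=> j; rewrite coef_map; apply: GO.
have polyO' (G : {poly N}) : G \is a polyOver (vsring O) ->
    map_poly e G \is a polyOver (vsring O').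
  by move=> /polyOverP GO; apply/polyOverP=> j; rewrite coef_map /= eO.
have zsO z : z \in zs -> z \in vsring O'.
  move=> zzs; apply: (@vs_integral _ O' (map_poly e (map_poly i H))).
  - by apply: polyO'; apply: polyO.
  - by rewrite !map_monic.
  - by rewrite Dzs root_prod_XsubC.
have [z zzs yz] : exists2 z, z \in zs & e y - z \in vsmax O'.
  apply: contrapT => no; have : e (map_poly i H).[y] \in vsmax O'.
    by rewrite (vsmax_map eO).
  rewrite -horner_map Dzs horner_prod.
  suff : \prod_(z <- zs) ('X - z%:P).[e y] \in vsunit O'.
    by rewrite vsunitE => /andP[_ /negPf ->].
  rewrite big_seq; apply: vsunit_prod => z zzs; rewrite hornerXsubC.
  have yzO : e y - z \in vsring O' by rewrite rpredB ?eO // zsO.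
  rewrite vsunit_max //.
  by apply/negP=> yz; apply: no; exists z.
have eyO : e y \in vsring O' by rewrite eO.
exists N', e, O', z; split=> // g gz.
pose g1 : {poly L} := g %% H.
have gE : (map_poly (e \o i) g).[z] = (map_poly (e \o i) g1).[z].
  rewrite {1}(divp_eq g H) rmorphD rmorphM hornerD hornerM /=.
  rewrite [map_poly _ H]map_poly_comp.
  suff -> : (map_poly e (map_poly i H)).[z] = 0 by rewrite mulr0 add0r.
  by apply/eqP; rewrite Dzs -/(root _ _) root_prod_XsubC.
have sg1 : (size g1 < size H)%N by rewrite ltn_modp.
rewrite gE in gz *; have g10 : g1 != 0.
  by apply: contraNneq gz => ->; rewrite rmorph0 horner0.
have [m g1m] := primitive_content OL g10; set g2 : {poly L} := _ *: g1 => g2p.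
have sg2 : (size g2 < size H)%N by rewrite size_scale ?invr_eq0.
exists g1`_m, g2; split=> //; first exact: primitiveW.
  (* if g2(y) is not a unit, then g2, cut off after its last unit coefficient and
     made monic, is a smaller H *)
  have g2O := primitiveW g2p.
  suff g2y : (map_poly i g2).[y] \in vsunit O.
    apply: (@vsunit_cong _ _ (e (map_poly i g2).[y])).
      by rewrite (vsunit_map eO).
    rewrite -horner_map map_poly_comp; apply: poly_cong => //; last exact: zsO.
    exact/polyO'/polyO.
  rewrite vsunit_max ?rpred_horner ?polyO //; apply/negP=> g2y.
  have exu : exists j, g2`_j \in vsunit OL by case: (primitiveP g2p) => j; exists j.
  have ubu j : g2`_j \in vsunit OL -> (j <= size g2)%N.
    by rewrite leqNgt => gj; apply/negP=> jg; move: gj; rewrite nth_default 1?ltnW // mem_vsunit eqxx.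
  have [j gj max_j] := @ex_maxnP (fun j => g2`_j \in vsunit OL) _ exu ubu.
  pose G := (g2`_j)^-1 *: take_poly j.+1 g2.
  have gj0 := vsunit_neq0 gj.
  have sT : size (take_poly j.+1 g2) = j.+1.
    apply/eqP; rewrite eqn_leq size_take_poly ltnNge /=.
    apply: contra gj0 => sT; have := nth_default 0 sT.
    by rewrite coef_take_poly ltnSn => ->.
  have sG : size G = j.+1 by rewrite size_scale ?invr_eq0.
  have := min_n G; rewrite leqNgt sG.
  have jg : (j < size g2)%N.
    by rewrite ltnNge; apply: contra gj0 => gsj; rewrite nth_default.
  rewrite (leq_ltn_trans jg sg2) => Gmin; suff : P G by move/Gmin.
  have gjO : (g2`_j)^-1 \in vsring OL by rewrite vsunitW ?vsunitV.
  split.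
  - by rewrite monicE lead_coefE sG coefZ coef_take_poly ltnSn mulVf.
  - apply/polyOverP=> l; rewrite coefZ rpredM // coef_take_poly.
    by case: ifP; rewrite ?rpred0 // (polyOverP g2O).
  - rewrite map_polyZ hornerZ vsmaxM //.
    have -> : take_poly j.+1 g2 = g2 - drop_poly j.+1 g2 * 'X^(j.+1).
      by rewrite -{2}(poly_take_drop j.+1 g2) addrK.
    rewrite rmorphB hornerD hornerN rpredB // rmorphM /= map_polyXn.
    rewrite hornerM hornerXn vsmaxMl ?rpredX // horner_coef rpred_sum // => l _.
    rewrite vsmaxMl ?rpredX // coef_map coef_drop_poly /=.
    rewrite (vsmax_map (mem_valsub_pre i O)) -[_ \in _]negbK -vsunit_max.
      apply/negP=> /max_j; by rewrite addnS ltnNge leq_addl.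
    exact: (polyOverP g2O).
by rewrite map_polyZ hornerZ mulrA -rmorphM divff // rmorph1 mul1r.
Qed.

(** * Separable constants: the immediate extension *)

(** Passing to quotients of polynomials in y: values and residues of the
    subfield generated by N1 and y are those of N1. *)
Lemma immediate_control (N1 N : fieldType) (e : {rmorphism N1 -> N})
    (O : valsub N) (y : N) :
    (forall h : {poly N1}, (map_poly e h).[y] != 0 ->
       exists c, e c / (map_poly e h).[y] - 1 \in vsmax O) ->
  forall x, x \in adjoin e y -> x != 0 ->
    exists c w, [/\ c != 0, w \in vsunit O, w - 1 \in vsmax O & x = e c * w].
Proof.
move=> imm x /adjoinP[g [h [h0 ->]]] gh0.
have g0 : (map_poly e g).[y] != 0 by apply: contraNneq gh0 => ->; rewrite mul0r.
have [c cg] := imm g g0; have [d dh] := imm h h0.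
move: cg dh; set G := _.[y] in g0 gh0 *; set H := _.[y] in h0 gh0 *.
set u := e c / G; set v := e d / H => um vm.
have one w : w - 1 \in vsmax O -> w \in vsunit O.
  by move=> wm; rewrite -(subrK 1 w) addrC vsunitD ?vsunit1.
have uU := one _ um; have vU := one _ vm.
have u0 := vsunit_neq0 uU; have v0 := vsunit_neq0 vU.
have c0 : e c != 0 by apply: contraNneq u0 => c0; rewrite /u c0 mul0r.
have d0 : e d != 0 by apply: contraNneq v0 => d0; rewrite /v d0 mul0r.
exists (c / d), (v / u); rewrite vsunitM ?vsunitV //; split=> //.
- by rewrite -(fmorph_eq0 e) fmorph_div mulf_neq0 ?invr_eq0.
- have -> : v / u - 1 = ((v - 1) - (u - 1)) / u by field.
  by apply: vsmaxMl; [rewrite rpredB|rewrite vsunitW ?vsunitV].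
- rewrite fmorph_div /u /v; field; by rewrite c0 d0 g0 h0.
Qed.

(** The image y of a is a root of f. The controlled subfield is generated by L,
    a root z congruent to y of a lift of the residual minimal polynomial, and y
    itself, which generates an immediate extension. *)
Lemma separable_datum (p : nat) (F E L N : fieldType)
    (s : {rmorphism F -> E}) (r : {rmorphism F -> L}) (i : {rmorphism L -> N})
    (O : valsub N) (a : E) (f : {poly F}) :
    (forall b, b != 0 -> i (r b) \in vsunit O) ->
    f \is monic -> irreducible_poly f -> (map_poly s f).[a] = 0 ->
    f^`() != 0 ->
  extension_datum p s r i O a.
Proof.
move=> rU fm fi fa f'0; pose OL := valsub_pre i O.
have rO b : i (r b) \in vsring O.
  by have [->|/rU/vsunitW //] := eqVneq b 0; rewrite !rmorph0 rpred0.
have firm : map_poly (i \o r) f \is monic by rewrite map_monic.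
have [N1 [e1 [O1 [rs [e1O Drs]]]]] := valued_splitting O firm.
pose q1 : {rmorphism F -> N1} := e1 \o (i \o r).
have q1O (g : {poly F}) : map_poly q1 g \is a polyOver (vsring O1).
  by apply/polyOverP=> n; rewrite coef_map /= e1O.
have {}Drs : map_poly q1 f = \prod_(r <- rs) ('X - r%:P).
  by rewrite -Drs -map_poly_comp.
have rsO x : x \in rs -> x \in vsring O1.
  move=> xrs; apply: (@vs_integral _ O1 (map_poly q1 f)) => //.
    by rewrite map_monic.
  by rewrite Drs root_prod_XsubC.
have f'f : coprimep f f^`().
  apply: irreducible_coprime => //; rewrite gtNdvdp //.
  exact/lt_size_deriv/monic_neq0.
have [[u w] /= bez] := Bezout_eq1_coprimepP _ _ f'f.
have [Urs far] : uniq rs /\ forall r1 r2, r1 \in rs -> r2 \in rs -> r1 != r2 ->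
    r1 - r2 \in vsunit O1.
  apply: (@separable_roots _ _ (map_poly q1 f) (map_poly q1 u) (map_poly q1 w)).
  - exact: q1O.
  - by rewrite deriv_map -!rmorphM -rmorphD bez rmorph1.
  - exact: Drs.
  - exact: rsO.
case: rs Drs rsO Urs far => [|y rs] Drs rsO Urs far.
  have [sf _] := fi; move: sf.
  by rewrite -(size_map_poly q1 f) Drs big_nil size_poly1.
have yrs : y \in y :: rs by rewrite mem_head.
have fy : (map_poly q1 f).[y] = 0.
  by apply/eqP; rewrite Drs -/(root _ _) root_prod_XsubC.
pose i1 : {rmorphism L -> N1} := e1 \o i.
have i1O x : (i1 x \in vsring O1) = (x \in vsring OL) by rewrite /= e1O.
have preE x : (x \in vsring (valsub_pre i1 O1)) = (x \in vsring OL) by rewrite -i1O.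
have rfm : map_poly r f \is monic by rewrite map_monic.
have [|||N2 [e2 [O2 [z [e2O yz gl]]]]] := @residue_generator L N1 i1 O1 y (map_poly r f) rfm.
- by apply/polyOverP=> n; rewrite coef_map /= preE; apply: rO.
- exact: rsO.
- rewrite -map_poly_comp; have -> : map_poly (i1 \o r) f = map_poly q1 f by [].
  by rewrite fy rpred0.
pose e : {rmorphism N -> N2} := e2 \o e1.
pose ei : {rmorphism L -> N2} := e2 \o i1.
have eiO x : (ei x \in vsring O2) = (x \in vsring OL) by rewrite /= e2O e1O.
have eO x : (e x \in vsring O2) = (x \in vsring O) by rewrite /= e2O e1O.
have {}gl (g : {poly L}) : (map_poly ei g).[z] != 0 -> exists c g',
      [/\ c != 0, g' \is a polyOver (vsring OL),
          (map_poly ei g').[z] \in vsunit O2 &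
          (map_poly ei g).[z] = ei c * (map_poly ei g').[z]].
  move=> gz; have [c [g' [c0 g'O gU gE]]] := gl g gz; exists c, g'; split=> //.
  by apply/polyOverP=> n; rewrite -preE (polyOverP g'O).
pose D1c := adjoin_closed ei z; pose L1 := subfield_type D1c.
pose i2 : {rmorphism L1 -> N2} := subfield_val D1c.
pose l1 : {rmorphism L -> L1} := subfield_lift D1c (adjoin_const ei z).
pose z1 : L1 := subfield_of D1c (adjoin_gen ei z).
have Df2 : map_poly i2 (map_poly (l1 \o r) f) =
    \prod_(x <- e2 y :: map e2 rs) ('X - x%:P).
  rewrite -map_cons big_map -map_poly_comp.
  rewrite (_ : map_poly (i2 \o (l1 \o r)) f = map_poly e2 (map_poly q1 f)).
    by rewrite Drs rmorph_prod; apply: eq_bigr => x _ /=; rewrite map_polyXsubC.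
  by rewrite -map_poly_comp.
have eyO : e2 y \in vsring O2 by rewrite e2O rsO.
have imm := @simple_root_immediate L1 N2 i2 O2 (map_poly (l1 \o r) f) (e2 y)
  (map e2 rs) z1.
have {}imm : forall h : {poly L1}, (map_poly i2 h).[e2 y] != 0 ->
    exists c, i2 c / (map_poly i2 h).[e2 y] - 1 \in vsmax O2.
  apply: imm => //.
  - by rewrite map_monic.
  - by rewrite -map_cons map_inj_uniq //; apply: fmorph_inj.
  - move=> _ /mapP[x xrs ->]; have -> : e2 x - i2 z1 = e2 (x - y) + (e2 y - z).
      by rewrite (_ : i2 z1 = z) // rmorphB; ring.
    rewrite vsunitD // (vsunit_map e2O) far ?mem_head ?inE ?xrs ?orbT //.
    by apply: contraTneq xrs => ->; case/andP: Urs.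
have ctrl := immediate_control imm.
exists N2, e, O2, (e2 y), (adjoin i2 (e2 y)).
have eirE (g : {poly F}) : (map_poly (e \o (i \o r)) g).[e2 y] =
    e2 (map_poly q1 g).[y] by rewrite -horner_map -map_poly_comp.
have eO2 (g : {poly F}) : (map_poly (e \o (i \o r)) g).[e2 y] \in vsring O2.
  by rewrite eirE e2O rpred_horner ?rsO.
split=> //.
- move=> g; split=> ga; last first.
    have fg : f %| g.
      apply: contraT => /(irreducible_coprime fi)/Bezout_eq1_coprimepP.
      case=> -[u' w'] /= bez'; have /eqP := congr1 (fun q => (map_poly s q).[a]) bez'.
      rewrite rmorphD !rmorphM rmorph1 hornerD !hornerM ga fa !mulr0 addr0.
      by rewrite hornerC eq_sym oner_eq0.
    by rewrite eirE -(divpK fg) rmorphM hornerM fy mulr0 rmorph0.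
  have fg : ~~ (f %| g).
    by apply: contra ga => fg; rewrite -(divpK fg) rmorphM hornerM fa mulr0.
  have /Bezout_eq1_coprimepP[[u' w'] /= bez'] := irreducible_coprime fi fg.
  have := congr1 (fun q => (map_poly (e \o (i \o r)) q).[e2 y]) bez'.
  rewrite rmorphD !rmorphM rmorph1 hornerD !hornerM [X in _ * X + _]eirE fy.
  rewrite rmorph0 mulr0 add0r hornerC mulrC => gw.
  have g0 : (map_poly (e \o (i \o r)) g).[e2 y] != 0.
    by apply/eqP=> g0; move/eqP: gw; rewrite g0 mul0r eq_sym oner_eq0.
  rewrite mem_vsunit g0 eO2 /=; rewrite (_ : _^-1 = (map_poly (e \o (i \o r)) w').[e2 y]) //.
  by apply: (mulfI g0); rewrite mulfV.
- split; first exact: adjoin_closed.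
  split=> [x|]; last exact: adjoin_gen.
  exact: (adjoin_const i2 (e2 y) (l1 x)).
- move=> Q Qc Qe x xD x0; have [c [w' [c0 wU _ ->]]] := ctrl _ xD x0.
  have [QU QM _ _] := Qc; apply: QM; last exact: QU.
  apply: (adjoin_value gl Qc Qe); first exact: (valP c).
  by rewrite fmorph_eq0.
- move=> R Rc Re Ry x xD xO; have [R1 Rm [RD RN] [RM RV] _] := Rc.
  have [->|x0] := eqVneq x 0; first by apply: Rm; apply: vsmax0.
  have [c [w' [c0 wU wm Dx]]] := ctrl _ xD x0.
  rewrite Dx; apply: RM; last by rewrite -(subrK 1 w'); apply: RD => //; apply: Rm.
  apply: (adjoin_residue eiO gl Rc) => //; last 2 first.
  + exact: (valP c).
  + rewrite (_ : i2 c = x / w'); last by rewrite Dx mulfK ?(vsunit_neq0 wU).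
    by rewrite rpredM // vsunitW ?vsunitV.
  rewrite -[z](subKr (e2 y)); apply: RD => //; apply: RN; exact: Rm.
Qed.

(** * The model containing all constants *)

(** All exponents of f are divisible by p; in characteristic 0 a nonconstant
    polynomial has a nonzero derivative. *)
Lemma deriv_eq0_comp (k F : fieldType) (w : {rmorphism k -> F}) (p : nat)
    (f : {poly F}) : char_exponent k p -> (1 < size f)%N -> f^`() = 0 ->
  p \in [pchar F] /\
    exists2 g : {poly F}, (size g < size f)%N & f = g \Po 'X^p.
Proof.
move=> hp sf f'0; have coef0 j : f`_j.+1 * j.+1%:R = 0.
  by rewrite mulr_natr -coef_deriv f'0 coef0.
have f0 : f != 0 by rewrite -size_poly_gt0 ltnW.
case: hp => [pk|[_ k0]]; last first.
  have F0 : [pchar F] =i pred0 by move=> q; rewrite (fmorph_pchar w).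
  case sz: (size f) sf => [|[|n]] // _; have /eqP := coef0 n.
  rewrite mulf_eq0 (iffLR (pcharf0P F) F0) orbF.
  have -> : f`_n.+1 = lead_coef f by rewrite lead_coefE sz.
  by rewrite lead_coef_eq0 (negbTE f0).
have pF : p \in [pchar F] by rewrite (fmorph_pchar w).
have p1 : (1 < p)%N := prime_gt1 (pcharf_prime pF).
have p0 : (0 < p)%N := ltnW p1.
pose g := \poly_(j < size f) f`_(j * p).
have Df : f = g \Po 'X^p.
  apply/polyP=> j; rewrite coef_comp_poly_Xn //; case: ifP => [pj|pj].
    rewrite coef_poly divnK //; case: ltnP => // gj.
    by rewrite nth_default // (leq_trans gj) // leq_div.
  case: j pj => [|j] pj; first by rewrite dvdn0 in pj.
  have /eqP := coef0 j; rewrite mulf_eq0 -(dvdn_pcharf pF) pj orbF.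
  by move/eqP.
split=> //; exists g => //.
have := size_comp_poly g 'X^p; rewrite -Df size_polyXn /= => sfg.
have : (0 < (size g).-1)%N.
  by case: ((size g).-1) sfg sf => // /eqP; case: (size f) => [|[|?]].
rewrite -(ltn_predK sf) sfg; case: (size g) => [|n] //= n0.
by rewrite ltnS -{1}[n]muln1 ltn_pmul2l.
Qed.

Section ModelStep.
Variables (K : fieldType) (OK : valsub K) (k E : fieldType).
Variables (kK : {rmorphism k -> K}) (kE : {rmorphism k -> E}) (p : nat).
Hypothesis hp : char_exponent k p.
Local Notation model := (model OK kK kE p).

Section OneModel.
Variable M : model.
Local Notation over t := (term_over (@mdom _ _ _ _ _ _ _ M) t).

(** The subfield generated by K and the constants. *)
Definition mgen : {pred mfield M} :=
  [pred x | `[< exists2 t, over t & x = mval M t >] ].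

Lemma mgenP x : reflect (exists2 t, over t & x = mval M t) (x \in mgen).
Proof. exact: asboolP. Qed.

Lemma mgen_closed : divring_closed mgen.
Proof.
split=> [|_ _ /mgenP[s os ->] /mgenP[t ot ->]|_ _ /mgenP[s os ->] /mgenP[t ot ->]];
  apply/mgenP.
- by exists (TK E 1); rewrite /mval //= rmorph1.
- by exists (TAdd s (TOpp t)); rewrite /= ?os ?ot.
- by exists (TMul s (TInv t)); rewrite /= ?os ?ot.
Qed.

Definition mgen_field := subfield_type mgen_closed.
HB.instance Definition _ := GRing.Field.on mgen_field.

Lemma mgen_const (b : mconst M) : mconst_eval b \in mgen.
Proof. by apply/mgenP; exists (TE K (mconst_val M b)); rewrite //= mconst_dom. Qed.

Definition mgen_hom : {rmorphism mconst M -> mgen_field} :=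
  subfield_lift mgen_closed mgen_const.

Lemma model_extension a :
    extension_datum p (mconst_val M) mgen_hom (subfield_val mgen_closed)
      (mring M) a ->
  exists2 M' : model, model_le M M' & mdom M' a.
Proof.
move=> [N [e [O [y [D [eO yP [Dc [DM Dy]] DQ DR]]]]]].
have gen t : over t -> exists x : mgen_field,
    mval M t = subfield_val mgen_closed x.
  move=> ot; have xM : mval M t \in mgen by apply/mgenP; exists t.
  by exists (subfield_of mgen_closed xM).
have genV (x : mgen_field) : exists2 t, over t &
    subfield_val mgen_closed x = mval M t.
  exact/mgenP/(valP x).
apply: (@model_adjoin _ _ _ _ _ _ _ hp M N e O eO a y _ _ D) => //.
- by move=> g; apply: (yP g).1.
- by move=> g; apply: (yP g).2.
- by move=> t /gen[x ->].
- move=> Q Qc QM x; apply: DQ => // c c0.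
  have [t ot ct] := genV c; rewrite ct; apply: QM => //.
  by rewrite -ct fmorph_eq0.
- move=> R Rc RM Ry x; apply: DR => // c cO.
  by have [t ot ct] := genV c; rewrite ct in cO *; apply: RM.
Qed.

Lemma mgen_hom_unit b : b != 0 ->
  subfield_val mgen_closed (mgen_hom b) \in vsunit (mring M).
Proof. exact: mconst_unit. Qed.

(** If every element outside the constants is algebraic over them, let a have
    the least degree. Its minimal polynomial f is irreducible. If f has zero
    derivative, a^p has smaller degree, hence is a constant; otherwise f is
    separable. *)
Lemma model_step a : ~~ mdom M a -> exists (M' : model) a',
  [/\ model_le M M', ~~ mdom M a' & mdom M' a'].
Proof.
move=> aM; pose s := mconst_val M.
suff [a' a'M dat] : exists2 a', ~~ mdom M a' &
    extension_datum p s mgen_hom (subfield_val mgen_closed) (mring M) a'.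
  by have [M' MM' a'M'] := model_extension dat; exists M', a'.
have [[a' a'M tr]|alg] := pselect (exists2 a', ~~ mdom M a' &
    forall g : {poly mconst M}, g != 0 -> (map_poly s g).[a'] != 0).
  by exists a' => //; apply: transcendental_datum tr; apply: mgen_hom_unit.
pose P n := exists a' (f : {poly mconst M}),
  [/\ ~~ mdom M a', f != 0, (map_poly s f).[a'] = 0 & size f = n].
have ex : exists n, `[< P n >].
  apply: contrapT => no; apply: alg; exists a => // g g0.
  by apply/eqP=> ga; apply: no; exists (size g); apply/asboolP; exists a, g.
case: (ex_minnP ex) => n /asboolP[{}a [f0 [{}aM f00 f0a sf0]]] min_n.
pose f : {poly mconst M} := (lead_coef f0)^-1 *: f0.
have l0 : lead_coef f0 != 0 by rewrite lead_coef_eq0.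
have fm : f \is monic by rewrite monicE lead_coefZ mulVf.
have sf : size f = n by rewrite size_scale ?invr_eq0.
have fa : (map_poly s f).[a] = 0 by rewrite map_polyZ hornerZ f0a mulr0.
have {}min_n b (g : {poly mconst M}) : ~~ mdom M b -> g != 0 ->
    (map_poly s g).[b] = 0 -> (size f <= size g)%N.
  by move=> bM g0 gb; rewrite sf; apply: min_n; apply/asboolP; exists b, g.
have fn0 : f != 0 := monic_neq0 fm.
have sf1 : (1 < size f)%N.
  rewrite ltnNge; apply/negP=> /size1_polyC fC.
  move: fa fn0; rewrite fC map_polyC hornerC => /eqP.
  by rewrite fmorph_eq0 => /eqP ->; rewrite eqxx.
have fi : irreducible_poly f.
  split=> // q sq qf; have Df := divpK qf.
  have q0 : q != 0 by apply: contraTneq qf => ->; rewrite dvd0p.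
  have h0 : f %/ q != 0 by apply: contraNneq fn0 => h0; rewrite -Df h0 mul0r.
  have : (map_poly s (f %/ q)).[a] * (map_poly s q).[a] == 0.
    by rewrite -hornerM -rmorphM Df fa.
  rewrite mulf_eq0 => /orP[/eqP ha|/eqP qa].
    have := min_n _ _ aM h0 ha; rewrite -{1}Df size_mul // => le_s.
    case/negP: sq; rewrite eqn_leq size_poly_gt0 q0 andbT.
    have : (0 < size (f %/ q)%R)%N by rewrite size_poly_gt0.
    by case: (size (f %/ q)) le_s => // m; rewrite addSn /= -addn1 leq_add2l.
  by rewrite -dvdp_size_eqp // eqn_leq dvdp_leq //= (min_n _ _ aM q0 qa).
have [f'0|f'0] := eqVneq f^`() 0; last first.
  by exists a => //; apply: (separable_datum _ mgen_hom_unit fm fi fa).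
have wk : {rmorphism k -> mconst M} :=
  subfield_lift (mdom_closed M) (fun b => mdomk M b).
have [pF [g sg Df]] := deriv_eq0_comp wk hp sf1 f'0.
have apM : mdom M (a ^+ p).
  have g0 : g != 0 by apply: contraNneq fn0 => g0; rewrite Df g0 comp_poly0.
  have ga : (map_poly s g).[a ^+ p] = 0.
    by rewrite -fa Df map_comp_poly map_polyXn horner_comp hornerXn.
  by apply: contraT => apM; have := min_n _ g apM g0 ga; rewrite leqNgt sg.
exists a => //.
exact: (@radical_datum _ _ _ _ _ _ _ _ _ _ mgen_hom_unit
          (subfield_of (mdom_closed M) apM)).
Qed.

End OneModel.

Hypothesis kO : forall b, kK b \in vsring OK.

(** The least model: K with its ring OK and the constants of k. *)
Definition base_dom (b : E) : bool := `[< exists c, b = kE c >].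
Definition base_elt (b : E) : K := xget 0 (fun z => exists2 c, b = kE c & z = kK c).

Lemma base_eltE c : base_elt (kE c) = kK c.
Proof.
rewrite /base_elt; case: xgetP => [z _ [c' /fmorph_inj -> ->] //|no].
by case: (no (kK c)); exists c.
Qed.

Lemma base_dom_closed : divring_closed (base_dom : {pred E}).
Proof.
split=> [|_ _ /asboolP[b ->] /asboolP[c ->]|_ _ /asboolP[b ->] /asboolP[c ->]];
  apply/asboolP.
- by exists 1; rewrite rmorph1.
- by exists (b - c); rewrite rmorphB.
- by exists (b / c); rewrite fmorph_div.
Qed.

Lemma base_elt1 : base_elt 1 = 1.
Proof. by rewrite -(rmorph1 kE) base_eltE rmorph1. Qed.

Lemma base_eltB b c : base_dom b -> base_dom c ->
  base_elt (b - c) = base_elt b - base_elt c.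
Proof.
by move=> /asboolP[x ->] /asboolP[y ->]; rewrite -rmorphB !base_eltE rmorphB.
Qed.

Lemma base_eltM b c : base_dom b -> base_dom c ->
  base_elt (b * c) = base_elt b * base_elt c.
Proof.
by move=> /asboolP[x ->] /asboolP[y ->]; rewrite -rmorphM !base_eltE rmorphM.
Qed.

Lemma base_domk c : base_dom (kE c).
Proof. by apply/asboolP; exists c. Qed.

Lemma base_ring b : base_dom b -> base_elt b \in vsring OK.
Proof. by move=> /asboolP[x ->]; rewrite base_eltE kO. Qed.

Lemma base_value t : term_over base_dom t ->
  eval (idfun : {rmorphism K -> K}) base_elt t != 0 ->
  value_over p OK (idfun : {rmorphism K -> K}) (eval idfun base_elt t).
Proof. by move=> _; apply: value_over_K. Qed.

Lemma base_residue t : term_over base_dom t ->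
  eval (idfun : {rmorphism K -> K}) base_elt t \in vsring OK ->
  residue_over OK p OK (idfun : {rmorphism K -> K}) base_dom base_elt
    (eval idfun base_elt t).
Proof.
move=> _ tO.
exact: (@residue_over_int _ OK E p K OK idfun base_dom base_elt (TK E _) tO).
Qed.

Definition base_model : model := @Model K OK k E kK kE p K OK idfun
  base_dom base_elt base_dom_closed base_elt1 base_eltB base_eltM base_domk
  base_eltE (fun=> erefl) base_ring base_value base_residue.

(** Zorn's lemma on shapes gives a model that model_step cannot enlarge. The
    union of the chain reduced to it has the same constants and is generated by
    them and K. *)
Lemma full_model : exists2 M : model, forall b, mdom M b &
  forall x : mfield M,
    exists2 t, term_over (mdom M) t & x = mval M t.
Proof.
pose T := {X | exists M : model, shape M = X}.
pose T0 : T := exist _ (shape base_model) (ex_intro _ base_model erefl).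
pose R (s t : T) : bool := `[< shape_le (sval s) (sval t) >].
have RP s t : reflect (shape_le (sval s) (sval t)) (R s t) by exact: asboolP.
have [|s r t /RP rs /RP st|A totA|t max_t] := @ZL_preorder T T0 R.
- by move=> t; apply/RP/shape_le_refl.
- by apply/RP; apply: shape_le_trans st.
- pose A' (M : model) := exists2 t, A t & shape M = sval t.
  have totA' M M' : A' M -> A' M' -> model_le M M' \/ model_le M' M.
    move=> [t At Mt] [t' At' Mt']; rewrite /model_le Mt Mt'.
    by have [/RP|/RP] := totA _ _ At At'; [left|right].
  have [[s0 As0]|A0] := pselect (exists s, A s); last first.
    by exists T0 => s As; case: A0; exists s.
  have [M0 M0s] := svalP s0; have A'0 : A' M0 by exists s0.
  exists (exist _ (shape (limmodel totA' A'0)) (ex_intro _ _ erefl)) => s As.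
  apply/RP => /=; have [M Ms] := svalP s; rewrite -Ms.
  by apply: limmodel_ge; exists s.
have [M Mt] := svalP t.
have Mfull b : mdom M b.
  apply: contraT => /model_step[M' [a [MM' aM aM']]].
  have tM' : R t (exist _ (shape M') (ex_intro _ M' erefl)).
    by apply/RP; rewrite -Mt.
  have /RP /= := max_t _ tM'; rewrite -Mt => -[dom_le _].
  by case/negP: aM; apply: dom_le.
have tot1 M1 M2 : M1 = M -> M2 = M -> model_le M1 M2 \/ model_le M2 M1.
  by move=> -> ->; left; apply: shape_le_refl.
exists (limmodel tot1 (erefl M)) => [b|x]; last exact: limmodel_generated.
by have [dom_le _] := limmodel_ge tot1 (erefl M) (erefl M); exact: dom_le _ (Mfull b).
Qed.

End ModelStep.

(** * The valuation ring of a full model *)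

Section FractionValuation.
Variable V : valuationRingType.
Local Notation "x %:F" := (FracField.tofrac x).

Definition frac_ring : {pred {fraction V}} :=
  [pred x | `[< exists v : V, x = v%:F >] ].

Lemma frac_ringP x : reflect (exists v : V, x = v%:F) (x \in frac_ring).
Proof. exact: asboolP. Qed.

Lemma frac_ring_closed : subring_closed frac_ring.
Proof.
split=> [|_ _ /frac_ringP[u ->] /frac_ringP[v ->]
         |_ _ /frac_ringP[u ->] /frac_ringP[v ->]]; apply/frac_ringP.
- by exists 1; rewrite rmorph1.
- by exists (u - v); rewrite rmorphB.
- by exists (u * v); rewrite rmorphM.
Qed.

Lemma frac_ring_total x : (x \in frac_ring) || (x^-1 \in frac_ring).
Proof.
have [u [v [v0 ->]]] := fraction_quotient x.
have [->|u0] := eqVneq u 0.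
  by apply/orP; left; apply/frac_ringP; exists 0; rewrite rmorph0 mul0r.
apply/orP; case: (valuation_total u v) => -[c Dc].
  right; apply/frac_ringP; exists c.
  by rewrite invf_div Dc rmorphM mulfK // tofrac_eq0.
left; apply/frac_ringP; exists c.
by rewrite {1}Dc rmorphM mulfK // tofrac_eq0.
Qed.

Definition frac_valsub : valsub {fraction V} :=
  ValSub frac_ring_closed frac_ring_total.

Lemma frac_valsubP x : reflect (exists v : V, x = v%:F)
  (x \in vsring frac_valsub).
Proof. exact: asboolP. Qed.

Lemma tofrac_ring v : v%:F \in vsring frac_valsub.
Proof. by apply/frac_valsubP; exists v. Qed.

Lemma tofrac_unit v : v%:F \in vsunit frac_valsub -> v \is a GRing.unit.
Proof.
move=> /and3P[v0 _ /frac_valsubP[u uv]]; apply/unitrP; exists u.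
have D : u * v = 1.
  by apply/eqP; rewrite -tofrac_eq tofracM -uv mulVf // tofrac1.
by rewrite D mulrC D.
Qed.
End FractionValuation.

Lemma mgvalMn (K : fieldType) (x : mulgroup K) n : mgval (x *+ n) = mgval x ^+ n.
Proof. by elim: n => [|n IHn]; rewrite ?expr0 // mulrS exprS -IHn. Qed.

(** Fractions are written as quotients of elements of the rings, which avoids
    comparing Frac W with another field. *)
Lemma value_quotient_torsion (V W : valuationRingType) (phi : domination V W)
    (p : nat) :
  (forall w1 w2 : W, w1 != 0 -> w2 != 0 -> exists n (v1 v2 : V) (u : W),
     [/\ v1 != 0, v2 != 0, u \is a GRing.unit &
         w1 ^+ (p ^ n) * phi v2 = w2 ^+ (p ^ n) * phi v1 * u]) ->
  p_torsion p (value_quotient phi).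
Proof.
move=> H x; rewrite -[x]reprK; set d := repr x; rewrite -[d]repr_value.
set y := repr d.
have [w1 [w2 [w20 Dy]]] := fraction_quotient (mgval y).
have w10 : w1 != 0.
  by apply: contraNneq (mgval_neq0 y) => w0; rewrite Dy w0 rmorph0 mul0r.
have [n [v1 [v2 [u [v10 v20 uU e12]]]]] := H _ _ w10 w20; exists n.
rewrite -raddfMn /= -[X in \pi X]raddfMn /=.
have c0 : FracField.tofrac v1 / FracField.tofrac v2 != 0.
  by rewrite mulf_neq0 ?invr_eq0 ?tofrac_eq0.
pose g := MulGroup c0.
have -> : value (y *+ (p ^ n)) = value (mulgroup_map phi g).
  apply/eqP; rewrite value_eq; apply/unit_subgroupP; exists u => //.
  rewrite mgvalB mgvalMn Dy /= frac_mapE // invf_div expr_div_n -!rmorphXn.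
  have cancel (F : fieldType) (a b c : F) :
      a != 0 -> b != 0 -> a * b * c / (a * b) = c.
    by move=> a0 b0; rewrite mulrAC divff ?mul1r // mulf_neq0.
  have pv1 := phi_neq0 phi v10; have pv2 := phi_neq0 phi v20.
  have w2n : FracField.tofrac (w2 ^+ (p ^ n)) != 0.
    by rewrite tofrac_eq0 expf_neq0.
  rewrite mulf_div -!tofracM e12 3!tofracM; exact: (cancel _ _ _ _ w2n pv1).
rewrite -value_mapE; apply/eqP.
have <- : \pi_(value_quotient phi) 0 = 0 by rewrite raddf0.
by rewrite -Quotient.idealrBE subr0; apply/asboolP; exists (value g).
Qed.

(** M is a model whose constants are all of k' and whose field is generated by
    Frac V and k'. *)
Section Assembly.
Variables (V : valuationRingType) (k k' : fieldType).
Variables (incl_V : {rmorphism k -> V}) (incl_k' : {rmorphism k -> k'}).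
Variables (p : nat) (hp : char_exponent k p).
Local Notation frac := (@FracField.tofrac V).
Local Notation kK := (frac \o incl_V : {rmorphism k -> {fraction V}}).
Local Notation OK := (frac_valsub V).
Local Notation model := (model OK kK incl_k' p).

Variable M : model.
Hypothesis M_full : forall b, mdom M b.
Hypothesis M_gen : forall x : mfield M,
  exists2 t, term_over (mdom M) t & x = mval M t.

Local Notation O := (mring M).
Definition full_ring : valuationRingType := vtype O.

Lemma full_valX (w : full_ring) n : val (w ^+ n) = val w ^+ n.
Proof. exact: (rmorphXn (@vt_val _ O)). Qed.

Lemma full_V_subproof v : mK M (frac v) \in vsring O.
Proof. by rewrite mringK tofrac_ring. Qed.
Definition full_V v : full_ring := vt_mk (full_V_subproof v).

Lemma full_V_zmod : zmod_morphism full_V.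
Proof. by move=> u v; apply: val_inj; rewrite /= !rmorphB. Qed.
Lemma full_V_monoid : monoid_morphism full_V.
Proof. by split=> [|u v]; apply: val_inj; rewrite /= ?rmorph1 ?rmorphM. Qed.
HB.instance Definition _ := GRing.isZmodMorphism.Build V full_ring
  full_V full_V_zmod.
HB.instance Definition _ := GRing.isMonoidMorphism.Build V full_ring
  full_V full_V_monoid.

Lemma full_V_inj : injective full_V.
Proof. by move=> u v /(congr1 val) /= /fmorph_inj /eqP; rewrite tofrac_eq => /eqP. Qed.

Lemma full_V_local v : full_V v \is a GRing.unit -> v \is a GRing.unit.
Proof.
by rewrite vt_unitE /= (vsunit_map (@mringK _ _ _ _ _ _ _ M)); apply: tofrac_unit.
Qed.

Definition full_dom : domination V full_ring :=
  @Domination V full_ring full_V full_V_inj full_V_local.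

Definition full_k' b : full_ring := vt_mk (@mringE _ _ _ _ _ _ _ M b (M_full b)).

Lemma full_k'_zmod : zmod_morphism full_k'.
Proof. by move=> b c; apply: val_inj; rewrite /= mEB ?M_full. Qed.
Lemma full_k'_monoid : monoid_morphism full_k'.
Proof.
by split=> [|b c]; apply: val_inj; rewrite /= ?mE1 // mEM ?M_full.
Qed.
HB.instance Definition _ := GRing.isZmodMorphism.Build k' full_ring
  full_k' full_k'_zmod.
HB.instance Definition _ := GRing.isMonoidMorphism.Build k' full_ring
  full_k' full_k'_monoid.

Lemma full_compat a : full_k' (incl_k' a) = full_dom (incl_V a).
Proof. by apply: val_inj; rewrite /= mEk. Qed.

Lemma full_value (w1 w2 : full_ring) : w1 != 0 -> w2 != 0 ->
  exists n (v1 v2 : V) (u : full_ring),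
    [/\ v1 != 0, v2 != 0, u \is a GRing.unit &
        w1 ^+ (p ^ n) * full_dom v2 = w2 ^+ (p ^ n) * full_dom v1 * u].
Proof.
move=> w10 w20; have z10 : val w1 != 0 by rewrite -(inj_eq val_inj) in w10.
have z20 : val w2 != 0 by rewrite -(inj_eq val_inj) in w20.
have [t ot Dt] := M_gen (val w1 / val w2).
have : mval M t != 0 by rewrite -Dt mulf_neq0 ?invr_eq0.
move=> /(mvalue ot); rewrite -/(mval M t) -Dt => -[n [c cU]].
have [v1 [v2 [v20 Dc]]] := fraction_quotient c.
have v10 : v1 != 0.
  apply: contraTneq cU => v10; rewrite Dc v10 !rmorph0 mul0r rmorph0 invr0.
  by rewrite mulr0 mem_vsunit eqxx.
exists n, v1, v2, (vt_mk (vsunitW cU)); split=> //; apply: val_inj => /=.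
rewrite !full_valX Dc fmorph_div expr_div_n.
have f1 : mK M (frac v1) != 0 by rewrite fmorph_eq0 tofrac_eq0.
have f2 : mK M (frac v2) != 0 by rewrite fmorph_eq0 tofrac_eq0.
have z2n : val w2 ^+ (p ^ n) != 0 by rewrite expf_neq0.
by field; rewrite f1 f2 z2n.
Qed.

Lemma over_full (t : term {fraction V} k') : term_over (mdom M) t.
Proof. by elim: t => //= s -> t ->. Qed.

Lemma integral_ring (t : term {fraction V} k') :
  integral_term OK t -> mval M t \in vsring O.
Proof.
move=> it; apply: integral_eval it (over_full t); first exact: mringK.
exact: mringE.
Qed.

Lemma full_residue_term (S : set (residue_field full_ring)) (t : term {fraction V} k') :
    divring_closed [pred x in S] ->
    (forall b, S (residue (full_k' b))) ->
    (forall x, S (residue_map full_dom x)) ->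
    integral_term OK t -> forall w : full_ring, val w = mval M t ->
  S (residue w).
Proof.
move=> Sc Sk SV.
have SE x : S x <-> x \in mk_divring Sc.
  by split=> [Sx|xS]; [apply/mem_set|apply/set_mem].
have SM x y : S x -> S y -> S (x * y).
  by move=> /SE Sx /SE Sy; apply/SE; rewrite rpredM.
have SD x y : S x -> S y -> S (x + y).
  by move=> /SE Sx /SE Sy; apply/SE; rewrite rpredD.
have SN x : S x -> S (- x) by move=> /SE Sx; apply/SE; rewrite rpredN.
elim: t => //= [x|b _ w wb|s IHs t IHt|s IHs t IHt|t IHt].
- move=> /frac_valsubP[v Dx] w wv.
  rewrite (_ : w = full_dom v) -?residue_mapE //.
  by apply: val_inj; rewrite [LHS]wv Dx.
- by rewrite (_ : w = full_k' b) //; apply: val_inj.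
- move=> /andP[is_ it] w Dw.
  have sO : mval M s \in vsring O := integral_ring is_.
  have tO : mval M t \in vsring O := integral_ring it.
  rewrite (_ : w = vt_mk sO + vt_mk tO); last exact: val_inj.
  by rewrite rmorphD; apply: SD; [apply: IHs|apply: IHt].
- move=> /andP[is_ it] w Dw.
  have sO : mval M s \in vsring O := integral_ring is_.
  have tO : mval M t \in vsring O := integral_ring it.
  rewrite (_ : w = vt_mk sO * vt_mk tO); last exact: val_inj.
  by rewrite rmorphM; apply: SM; [apply: IHs|apply: IHt].
- move=> it w Dw.
  have tO : mval M t \in vsring O := integral_ring it.
  rewrite (_ : w = - vt_mk tO); last exact: val_inj.
  by rewrite rmorphN; apply: SN; apply: IHt.
Qed.

Lemma full_residue : purely_inseparable_over
  (subfield_generated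
     (range (fun b : k' => residue (full_k' b)) `|`
      range (residue_map full_dom))%classic).
Proof.
move=> x; rewrite -[x]repr_residue; set w := repr x.
have [t ot Dt] := M_gen (val w).
have := mvalue ot; have := mresidue ot; rewrite -/(mval M t) -Dt.
move=> /(_ (valP w))[n [b [s [/andP[ib is_] _ sU sb]]]] _.
exists (p ^ n)%N.
  exact: (char_exponent_nat hp (@residue full_ring \o (full_k' \o incl_k'))).
have bO : mval M b \in vsring O := integral_ring ib.
have sO : mval M s \in vsring O := vsunitW sU.
pose b' : full_ring := vt_mk bO; pose s' : full_ring := vt_mk sO.
have s'U : s' \is a GRing.unit by rewrite vt_unitE.
have rs0 : residue s' != 0 by rewrite residue_eq0 s'U.
have -> : residue w ^+ (p ^ n) = residue b' / residue s'.
  apply: (mulIf rs0); rewrite divfK // -rmorphXn -rmorphM /=; apply/eqP.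
  rewrite residue_eq vt_unitE vsunitE negb_and negbK; apply/orP; right.
  by rewrite [_ * s']mulrC; move: sb; rewrite -full_valX.
move=> S [Sc SA].
have Sk c : S (residue (full_k' c)) by apply: SA; left; exists c.
have SV v : S (residue_map full_dom v) by apply: SA; right; exists v.
have Sb : S (residue b') := @full_residue_term S b Sc Sk SV ib b' erefl.
have Ss : S (residue s') := @full_residue_term S s Sc Sk SV is_ s' erefl.
apply/set_mem; case: Sc => _ _ Sdiv.
by apply: Sdiv; apply/mem_set.
Qed.

End Assembly.

Local Open Scope classical_set_scope.

Theorem mainTheorem3 (V : valuationRingType) (k k' : fieldType)
    (incl_V : {rmorphism k -> V}) (incl_k' : {rmorphism k -> k'})
    (p : nat) (hp : char_exponent k p) :
  exists (W : valuationRingType) (phi : domination V W)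
      (incl_W : {rmorphism k' -> W}),
    [/\ forall a : k, incl_W (incl_k' a) = phi (incl_V a),
        p_torsion p (value_quotient phi)
      & purely_inseparable_over
          (subfield_generated
             (range (fun b : k' => residue (incl_W b)) `|`
              range (residue_map phi)))].
Proof.
have [M M_full M_gen] := @full_model _ (frac_valsub V) k k'
  (@FracField.tofrac V \o incl_V) incl_k' p hp (fun b => tofrac_ring (incl_V b)).
exists (full_ring M), (full_dom M), (full_k' M_full); split.
- exact: full_compat.
- exact/value_quotient_torsion/full_value.
- exact: full_residue.
Qed.
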